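(* Let $f(z,w)=(p(z),q(z,w))$ be a polynomial skew product on $\mathbb{C}^2$ with $\deg p=\delta\ge 2$ and $\deg q\ge 2$, and let $(\gamma,d)$, $U=U_R$, $T_k$ and $f_0$ be associated with $f$ as described in the context. If $d\ge 2$, or if $d=1$ and $\delta\ne T_k$ for any $k$, then for large $R>0$ there is a biholomorphic map $\phi$ defined on $U$ (i.e. biholomorphic onto its image) that conjugates $f$ to $f_0$, that is, $\phi\circ f=f_0\circ\phi$ on $U$. Moreover, for any small $\varepsilon>0$ there is $R>0$ such that $|\phi_1-z|<\varepsilon|z|$ and $|\phi_2-w|<\varepsilon|w|$ on $U$, where $\phi=(\phi_1,\phi_2)$.
   Context: Write $p(z)=a_\delta z^\delta+o(z^\delta)$ (as $z\to\infty$) with $a_\delta\neq0$, and $q(z,w)=\sum_{i,j\ge0}b_{ij}z^iw^j$ (a polynomial). Newton polygon: $N(q)$ is the convex hull of the union of the sets $D(i,j)=\{(x,y)\in\mathbb{R}^2: x\le i,\ y\le j\}$ over all $(i,j)$ with $b_{ij}\ne0$. Let $(n_1,m_1),\dots,(n_s,m_s)$ be the vertices of $N(q)$, with $n_1<\dots<n_s$ and $m_1>\dots>m_s$. For $1\le k\le s-1$ let $T_k$ be the $y$-intercept of the line through $(n_k,m_k)$ and $(n_{k+1},m_{k+1})$ (if $s=1$ there are no $T_k$). For $R>0$, define $(\gamma,d)$, $l_1$, $l_2$ and the region $U=U_R\subset\mathbb{C}^2$ by cases (if several cases apply, any one of them may be chosen): - Case 1: $s=1$. $(\gamma,d)=(n_1,m_1)$,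 $l_1=l_2^{-1}=0$, $U=\{|z|>R,\ |w|>R\}$. - Case 2: $s>1$ and $\delta\le T_1$. $(\gamma,d)=(n_1,m_1)$, $l_1=\frac{n_2-n_1}{m_1-m_2}$, $l_2^{-1}=0$, $U=\{|z|>R,\ |w|>R|z|^{l_1}\}$. - Case 3: $s>1$ and $T_{s-1}\le\delta$. $(\gamma,d)=(n_s,m_s)$, $l_1=0$, $l_2=\frac{n_s-n_{s-1}}{m_{s-1}-m_s}$, $U=\{R<|w|<R^{-l_2}|z|^{l_2}\}$. - Case 4: $s>2$ and $T_{k-1}\le\delta\le T_k$ for some $2\le k\le s-1$. $(\gamma,d)=(n_k,m_k)$, $l_1=\frac{n_{k+1}-n_k}{m_k-m_{k+1}}$, $l_1+l_2=\frac{n_k-n_{k-1}}{m_{k-1}-m_k}$, $U=\{R|z|^{l_1}<|w|<R^{-l_2}|z|^{l_1+l_2}\}$. Finally $f_0(z,w)=(a_\delta z^\delta,\ b_{\gamma d}z^\gamma w^d)$. *)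

(* Defs.v *)
From HB Require Import structures.
From mathcomp Require Import all_boot all_order all_algebra.
From mathcomp Require Import polyXY complex.
From mathcomp Require Import all_classical all_reals all_analysis.

Set Implicit Arguments.
Unset Strict Implicit.
Unset Printing Implicit Defensive.

Import Order.TTheory GRing.Theory Num.Theory numFieldNormedType.Exports.
Import ComplexField.Normc.

Local Open Scope classical_set_scope.
Local Open Scope ring_scope.

(* [R[i]^o] carries the topology and the structure of a normed space over the
   field [R[i]], so [differentiable] below is complex differentiability. *)
Notation C2 R := (R[i]^o * R[i]^o)%type.

Section ComplexAnalysis.
Variable R : realType.
Implicit Types (U : set (C2 R)) (phi psi f g : C2 R -> C2 R).

(* Only meant for open [U]: [differentiable] is not relative to [U]. *)
Definition holomorphic_on U phi := forall u, U u -> differentiable phi u.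

Definition biholomorphic_onto_image U phi :=
  [/\ holomorphic_on U phi,
      open (phi @` U) &
      exists psi, holomorphic_on (phi @` U) psi /\
                  forall u, U u -> psi (phi u) = u].

(* The inclusion f(U) in U makes [phi \o f] meaningful for a [phi] that is
   defined on [U] only. *)
Definition conjugates_on U phi f g :=
  f @` U `<=` U /\ forall u, U u -> phi (f u) = g (phi u).

End ComplexAnalysis.

(* A polynomial q(z, w) is a [q : {poly {poly R[i]}}] whose outer variable is z:
   the coefficient b_ij of z^i w^j is [q`_i`_j], and q(z, w) is [q.[z, w]]. *)
Section SkewProduct.
Variable R : realType.
Implicit Types (p : {poly R[i]}) (q : {poly {poly R[i]}}).

Definition total_degree q : nat :=
  \max_(i < size q) \max_(j < size (q`_i)%R | (q`_i`_j != 0)%R) (i + j).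

Definition skew_product p q (u : C2 R) : C2 R := (p.[u.1], q.[u.1, u.2]).

Definition monomial_model p q (gamma d : nat) (u : C2 R) : C2 R :=
  (lead_coef p * u.1 ^+ (size p).-1, q`_gamma`_d * u.1 ^+ gamma * u.2 ^+ d).

End SkewProduct.

Section NewtonPolygon.
Variable R : realType.
Implicit Types (q : {poly {poly R[i]}}) (N : set (R^o * R^o)).

Definition convex_hull N : set (R^o * R^o) :=
  smallest (@convex_set R (R^o * R^o)%type) N.

Definition lower_quadrant (i j : nat) : set (R^o * R^o) :=
  [set P | P.1 <= i%:R /\ P.2 <= j%:R].

Definition newton_polygon q : set (R^o * R^o) :=
  convex_hull [set P | exists i j, q`_i`_j != 0 /\ lower_quadrant i j P].

Definition vertex N (P : R^o * R^o) :=
  N P /\ forall (A B : R^o * R^o) (t : R), N A -> N B -> 0 < t < 1 ->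
         P = t *: A + (1 - t) *: B -> A = P /\ B = P.

(* [V] lists the vertices of N(q), from left to right. *)
Definition newton_vertices q (V : seq (nat * nat)) :=
  sorted (fun v v' => (v.1 < v'.1)%N && (v'.2 < v.2)%N) V /\
  forall P, vertex (newton_polygon q) P <->
            exists2 v, v \in V & P = (v.1%:R, v.2%:R).

End NewtonPolygon.

(* The vertices are numbered from 0: entry [k] of [V] is (n_{k+1}, m_{k+1}), and
   [slope V k], [intercept V k] concern the segment from entry [k] to entry
   [k.+1], so that [intercept V k] is T_{k+1}. *)
Section Cases.
Variable R : realType.
Implicit Types (V : seq (nat * nat)) (k : nat).

Definition vx V k : R := (nth (0, 0)%N V k).1%:R.
Definition vy V k : R := (nth (0, 0)%N V k).2%:R.

Definition slope V k : R := (vx V k.+1 - vx V k) / (vy V k - vy V k.+1).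

Definition intercept V k : R :=
  vy V k - vx V k * ((vy V k.+1 - vy V k) / (vx V k.+1 - vx V k)).

(* [skew_case V delta gamma d U]: one of the (possibly several) cases applicable
   to [V] and [delta] gives the vertex (gamma, d) and the regions [U r], r > 0. *)
Inductive skew_case V (delta : nat) :
    nat -> nat -> (R -> set (C2 R)) -> Prop :=
| SkewCase1 gamma d :
    size V = 1%N ->
    nth (0, 0)%N V 0 = (gamma, d) ->
    skew_case V delta gamma d
      (fun r => [set u | r < normc u.1 /\ r < normc u.2])
| SkewCase2 gamma d (l1 : R) :
    (1 < size V)%N ->
    delta%:R <= intercept V 0 ->
    nth (0, 0)%N V 0 = (gamma, d) ->
    l1 = slope V 0 ->
    skew_case V delta gamma d
      (fun r => [set u | r < normc u.1 /\ r * normc u.1 `^ l1 < normc u.2])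
| SkewCase3 k gamma d (l2 : R) :
    size V = k.+2 ->
    intercept V k <= delta%:R ->
    nth (0, 0)%N V k.+1 = (gamma, d) ->
    l2 = slope V k ->
    skew_case V delta gamma d
      (fun r => [set u | r < normc u.2 /\
                         normc u.2 < r `^ (- l2) * normc u.1 `^ l2])
| SkewCase4 k gamma d (l1 l2 : R) :
    (k.+2 < size V)%N ->
    intercept V k <= delta%:R <= intercept V k.+1 ->
    nth (0, 0)%N V k.+1 = (gamma, d) ->
    l1 = slope V k.+1 ->
    l1 + l2 = slope V k ->
    skew_case V delta gamma d
      (fun r => [set u | r * normc u.1 `^ l1 < normc u.2 /\
                         normc u.2 < r `^ (- l2) * normc u.1 `^ (l1 + l2)]).

End Cases.

(* Main.v *)
Require Import Defs.
From HB Require Import structures.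
From mathcomp Require Import all_boot all_order all_algebra.
From mathcomp Require Import polyXY complex.
From mathcomp Require Import all_classical all_reals all_analysis.
From mathcomp Require Import ring lra.
Set Implicit Arguments.
Unset Strict Implicit.
Unset Printing Implicit Defensive.
Import Order.TTheory GRing.Theory Num.Theory numFieldNormedType.Exports.
Import ComplexField.Normc.
Local Open Scope classical_set_scope.
Local Open Scope ring_scope.

(** Write p = a z^delta (1 + zeta) and q = b z^gamma w^d (1 + eta). In the
    logarithmic coordinates x = ln|z|, y = ln|w|, all four regions have the form
    min(A, B) > ln R with A = y - l x and B = x - kap A, where l = l_1 and
    kap = l_2^{-1}. The Newton polygon conditions say that zeta and eta are sums
    of monomials of size exp(- c min(A, B)), and the conditions on delta that f
    maps min(A, B) > t into min(A, B) > t + Lam, with Lam as large as desired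
    once t is large.

    One looks for phi = (z exp E_1, w exp E_2). Then phi o f = f_0 o phi amounts to
      E_1 o f = delta E_1 - log(1 + zeta),
      E_2 o f = d E_2 - (log(1 + eta) - gamma E_1),
    and s E - E o f = h has the solution E = sum_n s^{-n-1} h o f^n, which
    converges because h decays along orbits (even when s = 1).

    No Cauchy theory is used. An increment of a point is a pair s of complex
    numbers acting by (z, w) |-> (z e^{s_1}, w e^{s_2}); f multiplies increments
    by at most a constant K, while the Lipschitz constants of h decay like
    exp(- c min(A, B)). So, for Lam large, the Lipschitz constants of the terms
    h o f^n are summable: this gives the differentiability of E. It also makes E
    a contraction in the increments, whence the injectivity of phi, the openness
    of its image (by a fixed point argument) and the differentiability of its
    inverse. *)

(** * Complex modulus and exponential *)

(** Up to bounded terms [f] acts linearly on the heights. With [e = gamma + l d - l delta] and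
    [g = delta - kap e - d], [A o f] is [(d + kap e) A + e B] and [B o f] is
    [kap g A + (delta - kap e) B]. Let T' be the intercept of the edge that ends at [(gamma, d)] and
    T that of the edge that starts there. When both edges exist, [e = l (T - delta)] and
    [g = (1 + l kap) (delta - T')], so the condition T' <= delta <= T makes all four coefficients
    nonnegative. On min(A, B) > t both heights of the image then exceed t times the sums of
    coefficients, [d + e + kap e] and [d + g + kap g], up to constants, and there is growth once
    both sums exceed 1. This is clear for [d >= 2]; for [d = 1] it needs [e > 0] and [g > 0], whence
    the exclusion of [delta = T_k]. If an edge is missing, the bounds on the degrees of p and q, or
    [gamma >= 1], take over. *)

Section ComplexModulus.
Variable R : realType.
Implicit Types (x y : R[i]) (a b : nat -> R[i]).

Lemma normc_triangle x y : normc (x + y) <= normc x + normc y.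
Proof. exact: le_normcD. Qed.

Lemma normc_opp x : normc (- x) = normc x.
Proof. exact: normcN. Qed.

Lemma normc_triangleB x y : normc (x - y) <= normc x + normc y.
Proof. by rewrite -(normc_opp y); exact: normc_triangle. Qed.

Lemma normc_distC x y : normc (x - y) = normc (y - x).
Proof. by rewrite -normc_opp opprB. Qed.

Lemma normc_0 : normc (0 : R[i]) = 0.
Proof. exact: normc0. Qed.

Lemma normc_1 : normc (1 : R[i]) = 1.
Proof. exact: normc1. Qed.

Lemma normc_ge0 x : 0 <= normc x.
Proof. by case: x => u v /=; exact: sqrtr_ge0. Qed.

Lemma normc_eq0 x : (normc x == 0) = (x == 0).
Proof. by apply/eqP/eqP => [/eq0_normc//|->]; exact: normc0. Qed.

Lemma normc_gt0 x : (0 < normc x) = (x != 0).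
Proof. by rewrite lt_def normc_ge0 andbT normc_eq0. Qed.

Lemma normc_X x n : normc (x ^+ n) = normc x ^+ n.
Proof.
by elim: n => [|n IH]; [rewrite !expr0; exact: normc_1|rewrite !exprS normcM IH].
Qed.

Lemma normc_div x y : normc (x / y) = normc x / normc y.
Proof. by rewrite normcM normcV. Qed.

Lemma normc_real (r : R) : normc (r%:C)%C = `|r|.
Proof. by rewrite /= expr0n /= addr0 sqrtr_sqr. Qed.

Lemma normc_nat n : normc (n%:R : R[i]) = n%:R.
Proof. by rewrite -(rmorph_nat (real_complex R)) normc_real normr_nat. Qed.

Lemma normc_ge_Re_Im x : `|complex.Re x| <= normc x /\ `|complex.Im x| <= normc x.
Proof.
case: x => u v /=; split.
- by rewrite -sqrtr_sqr ler_sqrt ?lerDl ?addr_ge0 ?sqr_ge0.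
- by rewrite -sqrtr_sqr ler_sqrt ?lerDr ?addr_ge0 ?sqr_ge0.
Qed.

Lemma normc_le_Re_Im x : normc x <= `|complex.Re x| + `|complex.Im x|.
Proof.
case: x => u v /=; rewrite -(ler_pXn2r (n:=2)) ?nnegrE ?sqrtr_ge0 ?addr_ge0 //.
rewrite sqr_sqrtr ?addr_ge0 ?sqr_ge0 // sqrrD !real_normK ?num_real //.
by rewrite addrAC lerDl mulrn_wge0 // mulr_ge0.
Qed.

Lemma normC_normc x : `|x| = (normc x)%:C%C.
Proof. by rewrite normc_def; case: x. Qed.

Lemma half_pow_gt0 n : 0 < (2^-1 : R) ^+ n.
Proof. by rewrite exprn_gt0 // invr_gt0. Qed.

Lemma half_pow_small (e : R) : 0 < e -> exists n, 2^-1 ^+ n < e.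
Proof.
move=> e0; have [n hn] : exists n : nat, e^-1 < n%:R.
  by exists (Num.bound e^-1); rewrite archi_boundP // invr_ge0 ltW.
exists n; rewrite exprVn invf_plt ?posrE ?exprn_gt0 //.
apply: (lt_trans hn); rewrite -natrX ltr_nat; exact: ltn_expl.
Qed.

Lemma le_geometric_eps (a b C : R) :
  (forall n, a <= b + C * 2^-1 ^+ n) -> a <= b.
Proof.
move=> h; rewrite leNgt; apply/negP => ba.
have C1 : 0 < `|C| + 1 by rewrite ltr_wpDl.
have ab : 0 < a - b by rewrite subr_gt0.
have [n] := half_pow_small (divr_gt0 ab C1).
rewrite ltr_pdivlMr // => h1; have h2 := h n.
have h3 : C * 2^-1 ^+ n <= (`|C| + 1) * 2^-1 ^+ n.
  by rewrite ler_wpM2r ?(ltW (half_pow_gt0 n)) // (le_trans (ler_norm C)) // lerDl.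
lra.
Qed.

(** The intervals of centre [a n] and radius [2 * C * 2^-1 ^+ n] are nested, because the radius
    drops at each step by exactly the allowed increment; the supremum of their left ends lies in all
    of them. *)
Lemma real_geometric_limit (a : nat -> R) (C : R) :
  (forall n, `|a n.+1 - a n| <= C * 2^-1 ^+ n) ->
  exists l, forall n, `|a n - l| <= 2 * C * 2^-1 ^+ n.
Proof.
move=> h; pose lo n := a n - 2 * C * 2^-1 ^+ n.
pose hi n := a n + 2 * C * 2^-1 ^+ n.
have C0 : 0 <= C by have := h 0%N; rewrite expr0 mulr1; apply: le_trans.
have step n : 2 * C * 2^-1 ^+ n.+1 = C * 2^-1 ^+ n.
  by rewrite exprS; field.
have nn k n : lo n <= lo (n + k)%N /\ hi (n + k)%N <= hi n.
  elim: k => [|k [IH1 IH2]]; first by rewrite addn0.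
  have := h (n + k)%N; rewrite ler_norml => /andP[h1 h2].
  have := step (n + k)%N; rewrite addnS.
  rewrite /lo /hi in IH1 IH2 * => st; rewrite !st.
  by split; lra.
have lohi n : lo n <= hi n.
  have : 0 <= 2 * C * 2^-1 ^+ n.
    by rewrite !mulr_ge0 // ltW // half_pow_gt0.
  rewrite /lo /hi; lra.
have lh n k : lo n <= hi k.
  have [h1 _] := nn k n; have [_ h2] := nn n k.
  by apply: (le_trans h1); apply: le_trans h2; rewrite addnC.
have hs : has_sup (range lo).
  split; first by exists (lo 0%N), 0%N.
  by exists (hi 0%N) => _ [n _ <-].
exists (sup (range lo)) => n; rewrite ler_norml.
have : lo n <= sup (range lo) by apply: sup_upper_bound => //; exists n.
have : sup (range lo) <= hi n.
  by apply: ge_sup; [exact: hs.1|move=> _ [k _ <-]].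
by rewrite /lo /hi => h1 h2; apply/andP; split; lra.
Qed.

Lemma complex_geometric_limit a (C : R) :
  (forall n, normc (a n.+1 - a n) <= C * 2^-1 ^+ n) ->
  exists l, forall n, normc (a n - l) <= 4 * C * 2^-1 ^+ n.
Proof.
move=> h.
have h1 n : `|complex.Re (a n.+1) - complex.Re (a n)| <= C * 2^-1 ^+ n.
  have [+ _] := normc_ge_Re_Im (a n.+1 - a n).
  by rewrite raddfB /= => /le_trans; apply.
have h2 n : `|complex.Im (a n.+1) - complex.Im (a n)| <= C * 2^-1 ^+ n.
  have [_ +] := normc_ge_Re_Im (a n.+1 - a n).
  by rewrite raddfB /= => /le_trans; apply.
have [l1 hl1] := real_geometric_limit h1.
have [l2 hl2] := real_geometric_limit h2.
exists (l1 +i* l2)%C => n.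
apply: (le_trans (normc_le_Re_Im _)); rewrite !raddfB /=.
by have := hl1 n; have := hl2 n; lra.
Qed.

(* The norm on pairs that measures increments in logarithmic coordinates. *)
Definition norm1 (s : R[i] * R[i]) : R := normc s.1 + normc s.2.

Lemma norm1_ge0 s : 0 <= norm1 s.
Proof. by rewrite addr_ge0 ?normc_ge0. Qed.

Lemma norm10 : norm1 0 = 0.
Proof. by rewrite /norm1 -[RHS]addr0; congr (_ + _); exact: normc_0. Qed.

Lemma norm1_triangle s t : norm1 (s + t) <= norm1 s + norm1 t.
Proof.
by rewrite /norm1 /=; have := normc_triangle s.1 t.1;
   have := normc_triangle s.2 t.2; lra.
Qed.

Lemma norm1_distC s t : norm1 (s - t) = norm1 (t - s).
Proof. by rewrite /norm1 /= (normc_distC s.1) (normc_distC s.2). Qed.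

Lemma norm1_eq0 s : norm1 s <= 0 -> s = 0.
Proof.
case: s => s t; rewrite /norm1 /= => h.
have h1 := normc_ge0 s; have h2 := normc_ge0 t.
have /eq0_normc -> : normc s = 0 by lra.
by have /eq0_normc -> : normc t = 0 by lra.
Qed.

(** Banach iteration from 0. The ball of radius [rho] is invariant: its image stays within [rho / 2]
    of [Th 0], itself of norm at most [rho / 2]. This yields both the logarithm near 1 and the
    openness of the image of [phi]. *)
Lemma contraction_fixpoint (Th : R[i] * R[i] -> R[i] * R[i]) (rho : R) :
  0 <= rho -> norm1 (Th 0) <= rho / 2 ->
  (forall s t, norm1 s <= rho -> norm1 t <= rho ->
     norm1 (Th s - Th t) <= norm1 (s - t) / 2) ->
  exists s, norm1 s <= rho /\ Th s = s.
Proof.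
move=> rho0 h0 hc; pose x n := iter n Th 0.
have n0 : norm1 0 <= rho by rewrite norm10.
have xS n : x n.+1 = Th (x n) by [].
have xb n : norm1 (x n) <= rho.
  elim: n => [//|n IH]; rewrite xS.
  rewrite -(subrK (Th 0) (Th (x n))); apply: (le_trans (norm1_triangle _ _)).
  have := hc _ _ IH n0; rewrite subr0; lra.
have xd n : norm1 (x n.+1 - x n) <= rho / 2 * 2^-1 ^+ n.
  elim: n => [|n IH]; first by rewrite expr0 mulr1 subr0.
  rewrite (xS n.+1) {2}(xS n) exprS.
  by apply: le_trans (hc _ _ (xb n.+1) (xb n)) _; lra.
have [l1 hl1] : exists l, forall n, normc ((x n).1 - l) <= 4 * (rho / 2) * 2^-1 ^+ n.
  apply: complex_geometric_limit => n; apply: le_trans (xd n).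
  by rewrite /norm1 /= lerDl normc_ge0.
have [l2 hl2] : exists l, forall n, normc ((x n).2 - l) <= 4 * (rho / 2) * 2^-1 ^+ n.
  apply: complex_geometric_limit => n; apply: le_trans (xd n).
  by rewrite /norm1 /= lerDr normc_ge0.
pose l : R[i] * R[i] := (l1, l2).
have hl n : norm1 (x n - l) <= 4 * rho * 2^-1 ^+ n.
  by rewrite /norm1 /=; have := hl1 n; have := hl2 n; lra.
have lb : norm1 l <= rho.
  apply: (@le_geometric_eps _ _ (4 * rho)) => n.
  rewrite -[l in norm1 l](subrK (x n)); apply: (le_trans (norm1_triangle _ _)).
  by rewrite norm1_distC; have := hl n; have := xb n; lra.
exists l; split => //; apply/eqP; rewrite -subr_eq0; apply/eqP; apply: norm1_eq0.
apply: (@le_geometric_eps _ _ (4 * rho)) => n; rewrite add0r.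
have -> : Th l - l = (Th l - Th (x n)) + (x n.+1 - l).
  by rewrite xS addrA subrK.
apply: (le_trans (norm1_triangle _ _)).
have := hc _ _ lb (xb n); rewrite norm1_distC.
by have := hl n; have := hl n.+1; rewrite exprS (norm1_distC l); lra.
Qed.

End ComplexModulus.

#[local] Arguments normc : simpl never.

Section ComplexExponential.
Variable R : realType.
Implicit Types (x y t : R[i]).

Definition cexp t : R[i] :=
  ((expR (complex.Re t) * cos (complex.Im t)) +i* (expR (complex.Re t) * sin (complex.Im t)))%C.

Lemma cexp0 : cexp 0 = 1.
Proof. by rewrite /cexp /= expR0 cos0 sin0 mulr1 mulr0. Qed.

Lemma cexpD x y : cexp (x + y) = cexp x * cexp y.
Proof.
case: x y => [a b] [c d]; rewrite /cexp /= expRD cosD sinD.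
by congr Complex; ring.
Qed.

Lemma cexp_neq0 x : cexp x != 0.
Proof.
apply/eqP => h; have := cexpD x (- x); rewrite subrr cexp0 h mul0r.
by apply/eqP; rewrite oner_eq0.
Qed.

Lemma cexpN x : cexp (- x) = (cexp x)^-1.
Proof.
by apply: (mulfI (cexp_neq0 x)); rewrite -cexpD subrr cexp0 divff ?cexp_neq0.
Qed.

Lemma cexpB x y : cexp (x - y) = cexp x / cexp y.
Proof. by rewrite cexpD cexpN. Qed.

Lemma cexp_natM n x : cexp (n%:R * x) = cexp x ^+ n.
Proof.
elim: n => [|n IH]; first by rewrite mul0r cexp0.
by rewrite -natr1 mulrDl mul1r cexpD IH exprSr.
Qed.

Lemma normc_cexp x : normc (cexp x) = expR (complex.Re x).
Proof.
rewrite /normc /cexp /= !exprMn -mulrDr cos2Dsin2 mulr1 sqrtr_sqr.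
by rewrite ger0_norm // expR_ge0.
Qed.

Lemma sin_le_id (b : R) : 0 <= b -> exists2 c, 0 <= c <= b & sin b = cos c * b.
Proof.
move=> b0; have [c hc] := @MVT_segment R sin cos 0 b b0
  (fun (r : R) _ => is_derive_sin r) (continuous_subspaceT (@continuous_sin R)).
by rewrite sin0 !subr0 => e; exists c.
Qed.

Lemma norm_sin_le (b : R) : `|sin b| <= `|b|.
Proof.
wlog b0 : b / 0 <= b => [h|].
  have [|b0] := lerP 0 b; first exact: h.
  by rewrite -normrN -sinN -(normrN b); apply: h; rewrite oppr_ge0 ltW.
have [c _ ->] := sin_le_id b0; rewrite normrM ler_piMl //.
by rewrite ler_norml cos_geN1 cos_le1.
Qed.

Lemma one_sub_cos_le (b : R) : 0 <= 1 - cos b <= b ^+ 2.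
Proof.
rewrite subr_ge0 cos_le1 /=.
have {1}-> : b = (b / 2) *+ 2 by rewrite -mulr_natr divfK // pnatr_eq0.
rewrite cos_mulr2n cos2sin2.
have : (sin (b / 2)) ^+ 2 <= (b / 2) ^+ 2.
  rewrite -[sin _ ^+ 2]real_normK ?num_real // -[(b / 2) ^+ 2]real_normK ?num_real //.
  by rewrite ler_pXn2r ?nnegrE //; exact: norm_sin_le.
rewrite exprMn; have := sqr_ge0 b; lra.
Qed.

Lemma norm_sin_sub_le (b : R) : `|b| <= 1 -> `|sin b - b| <= b ^+ 2.
Proof.
wlog b0 : b / 0 <= b => [h|].
  have [|b0] := lerP 0 b; first exact: h.
  rewrite -normrN => hb; rewrite -normrN opprB addrC -sinN -sqrrN.
  have -> : sin (- b) + b = sin (-b) - (- b) by rewrite opprK.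
  by apply: h => //; rewrite oppr_ge0 ltW.
rewrite ger0_norm // => b1; have [c /andP[c0 cb] ->] := sin_le_id b0.
have /andP[h1 h2] := one_sub_cos_le c.
have -> : cos c * b - b = - ((1 - cos c) * b) by ring.
rewrite normrN ger0_norm ?mulr_ge0 //.
have : c ^+ 2 <= b by rewrite expr2; nra.
move=> h3; rewrite (expr2 b) ler_wpM2r //; lra.
Qed.

(** For the upper bound, [expR (- a) >= 1 - a] gives [expR a * (1 - a) <= 1], so the middle term is
    at most [a ^+ 2 / (1 - a)], where [1 - a >= 1 / 2]. *)
Lemma expR_sub_bound (a : R) : `|a| <= 1 / 2 -> 0 <= expR a - 1 - a <= 2 * a ^+ 2.
Proof.
rewrite ler_norml => /andP[h1 h2].
have := expR_ge1Dx a; have := expR_ge1Dx (- a); rewrite expRN => h3 h4.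
have e0 := expR_gt0 a.
have : expR a * (1 - a) <= 1.
  by rewrite -[leRHS](mulfV (lt0r_neq0 e0)) ler_wpM2l // ltW.
move=> h5; apply/andP; split; first lra.
rewrite expr2; nra.
Qed.

Lemma normc_cexp_sub_id t :
  normc t <= 1 / 2 -> normc (cexp t - 1 - t) <= 8 * normc t ^+ 2.
Proof.
move=> ht; have [h1 h2] := normc_ge_Re_Im t.
case: t => a b in ht h1 h2 *; set n := normc _ in ht h1 h2 *; rewrite /= in h1 h2.
apply: (le_trans (normc_le_Re_Im _)); rewrite /cexp /= .
have n0 : 0 <= n := normc_ge0 _.
have ha : `|a| <= 1 / 2 by lra.
have /andP[e1 e2] := expR_sub_bound ha.
have /andP[c1 c2] := one_sub_cos_le b.
have hb : `|b| <= 1 by lra.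
have s1 := norm_sin_sub_le hb.
have sqa : a ^+ 2 <= n ^+ 2.
  by rewrite -(real_normK (num_real a)) ler_pXn2r ?nnegrE.
have sqb : b ^+ 2 <= n ^+ 2.
  by rewrite -(real_normK (num_real b)) ler_pXn2r ?nnegrE.
have ab : `|a| * `|b| <= n ^+ 2 by rewrite expr2 ler_pM.
have e3 : expR a <= 2 by move: ha; rewrite ler_norml => /andP[? ?]; nra.
have e0 := expR_ge0 a.
rewrite subr0.
have -> : expR a * cos b - 1 - a = (expR a - 1 - a) - expR a * (1 - cos b) by ring.
have -> : expR a * sin b - b = (expR a - 1 - a) * b + a * b + expR a * (sin b - b).
  by ring.
have i1 : `|(expR a - 1 - a) - expR a * (1 - cos b)| <= 4 * n ^+ 2.
  rewrite ler_norml; apply/andP; split; nra.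
have i2 : `|(expR a - 1 - a) * b + a * b + expR a * (sin b - b)| <= 4 * n ^+ 2.
  apply: (le_trans (ler_normD _ _)); apply: (le_trans (lerD (ler_normD _ _) (lexx _))).
  rewrite !normrM (ger0_norm e1) (ger0_norm e0).
  have : (expR a - 1 - a) * `|b| <= 2 * a ^+ 2 * (1 / 2) by rewrite ler_pM //; lra.
  have : expR a * `|sin b - b| <= 2 * b ^+ 2 by rewrite ler_pM.
  lra.
lra.
Qed.

(** The quadratic remainder is at most half of [normc t] as soon as [8 * normc t <= 1 / 2]; this is
    the origin of the radius [1 / 16], here and below. *)
Lemma normc_cexp_sub1 t : normc t <= 1 / 16 ->
  normc t / 2 <= normc (cexp t - 1) <= 2 * normc t.
Proof.
move=> ht; have n0 := normc_ge0 t.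
have h : normc (cexp t - 1 - t) <= normc t / 2.
  apply: (le_trans (normc_cexp_sub_id _)); first lra.
  rewrite expr2; nra.
have h1 := normc_triangle (cexp t - 1 - t) t.
have h2 := normc_triangleB (cexp t - 1) (cexp t - 1 - t).
rewrite subrK in h1; rewrite opprB addrC subrK in h2.
by apply/andP; split; lra.
Qed.

End ComplexExponential.

(** * Logarithm near 1 and differentiability criteria *)

Section LogarithmNearOne.
Variable R : realType.
Implicit Types (x y t : R[i]).

Lemma cexp_surj_near1 x : normc x <= 1 / 128 ->
  exists y, normc y <= 1 / 64 /\ cexp y = 1 + x.
Proof.
move=> hx.
(* The equation [cexp y = 1 + x] is read as [y = x - (cexp y - 1 - y)], whose right side varies
   slowly with [y]. The second coordinate is a dummy, the fixed point lemma being about pairs. *)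
pose Th (s : R[i] * R[i]) : R[i] * R[i] := (x - (cexp s.1 - 1 - s.1), 0).
have [||s t hs ht|[s1 s2] [h1 h2]] := @contraction_fixpoint R Th (1 / 64).
- by lra.
- by rewrite /norm1 /= cexp0 subrr !subr0 normc_0; lra.
- rewrite /norm1 /= subrr normc_0 addr0.
  have s0 := normc_ge0 s.1; have t0 := normc_ge0 t.1.
  have s20 := normc_ge0 s.2; have t20 := normc_ge0 t.2.
  rewrite /norm1 in hs ht.
  set d := s.1 - t.1.
  have hd : normc d <= 1 / 32.
    by apply: (le_trans (normc_triangleB _ _)); lra.
  have d0 := normc_ge0 d.
  have -> : x - (cexp s.1 - 1 - s.1) - (x - (cexp t.1 - 1 - t.1)) =
            - (cexp t.1 * (cexp d - 1 - d) + (cexp t.1 - 1) * d).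
    have -> : s.1 = t.1 + d by rewrite /d addrC subrK.
    by rewrite cexpD; ring.
  rewrite normc_opp; apply: (le_trans (normc_triangle _ _)); rewrite !normcM.
  have h1 : normc (cexp t.1 - 1) <= 1 / 32.
    have /andP[_ h] : normc t.1 / 2 <= normc (cexp t.1 - 1) <= 2 * normc t.1.
      by apply: normc_cexp_sub1; lra.
    by lra.
  have h2 : normc (cexp t.1) <= 33 / 32.
    rewrite -(subrK 1 (cexp t.1)); apply: (le_trans (normc_triangle _ _)).
    by rewrite normc_1; lra.
  have h3 : normc (cexp d - 1 - d) <= 8 * normc d ^+ 2.
    by apply: normc_cexp_sub_id; lra.
  have h4 : normc (cexp t.1) * normc (cexp d - 1 - d) <= 33 / 32 * (8 * normc d ^+ 2).
    by rewrite ler_pM ?normc_ge0.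
  have h5 : normc (cexp t.1 - 1) * normc d <= 1 / 32 * normc d.
    by rewrite ler_wpM2r.
  have := normc_ge0 (s.2 - t.2); rewrite expr2 in h4; nra.
- exists s1; move: h1; rewrite /norm1 /= => h1; split.
    by have := normc_ge0 s2; lra.
  case: h2 => h _; apply/eqP; rewrite -subr_eq0; apply/eqP.
  have -> : cexp s1 - (1 + x) = s1 - (x - (cexp s1 - 1 - s1)) by ring.
  by rewrite h subrr.
Qed.

(* The principal logarithm of [1 + x]; meaningful only for [normc x <= 1/128]. *)
Definition clog1p x : R[i] := xget 0 [set y | normc y <= 1 / 64 /\ cexp y = 1 + x].

Lemma clog1pP x : normc x <= 1 / 128 ->
  normc (clog1p x) <= 1 / 64 /\ cexp (clog1p x) = 1 + x.
Proof. by move=> /cexp_surj_near1; exact: xgetPex. Qed.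

(** The number [cexp (clog1p x - clog1p y) - 1] is [(x - y) / (1 + y)], and the difference of the
    logarithms is at most [1 / 32], a range where [cexp t - 1] has modulus at least
    [normc t / 2]. *)
Lemma clog1p_lipschitz x y : normc x <= 1 / 128 -> normc y <= 1 / 128 ->
  normc (clog1p x - clog1p y) <= 3 * normc (x - y).
Proof.
move=> hx hy; have [lx ex] := clog1pP hx; have [ly ey] := clog1pP hy.
have /andP[h _] : normc (clog1p x - clog1p y) / 2 <=
  normc (cexp (clog1p x - clog1p y) - 1) <= 2 * normc (clog1p x - clog1p y).
  apply: normc_cexp_sub1; apply: (le_trans (normc_triangleB _ _)); lra.
have y1 : 127 / 128 <= normc (1 + y).
  have := normc_triangleB (1 + y) y; rewrite addrK normc_1; lra.
have y0 : 1 + y != 0 by rewrite -normc_gt0; lra.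
have e : (cexp (clog1p x - clog1p y) - 1) * (1 + y) = x - y.
  by rewrite cexpB ex ey mulrBl divfK //; ring.
have := congr1 (@normc R) e; rewrite normcM => e'.
have := normc_ge0 (cexp (clog1p x - clog1p y) - 1).
nra.
Qed.

Lemma clog1p0 : clog1p 0 = 0.
Proof.
have h0 : normc 0 <= 1 / 128 :> R by rewrite normc_0; lra.
have [h1 h2] := clog1pP h0; apply: eq0_normc.
have /andP[h3 _] : normc (clog1p 0) / 2 <= normc (cexp (clog1p 0) - 1) <= 2 * normc (clog1p 0).
  by apply: normc_cexp_sub1; lra.
have := normc_ge0 (clog1p 0); rewrite h2 addr0 subrr normc_0 in h3; lra.
Qed.

Lemma clog1p_le x : normc x <= 1 / 128 -> normc (clog1p x) <= 3 * normc x.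
Proof.
move=> hx; have h0 : normc 0 <= 1 / 128 :> R by rewrite normc_0; lra.
by have := clog1p_lipschitz hx h0; rewrite clog1p0 !subr0.
Qed.

(** The linear term is exactly [cexp l - 1], with [l] the difference of the logarithms. The
    remainder bound of [cexp] then gives the constant 72, which is 8 times the square of the
    Lipschitz constant 3. *)
Lemma clog1p_taylor x y : normc x <= 1 / 128 -> normc y <= 1 / 128 ->
  normc (clog1p x - clog1p y - (1 + y)^-1 * (x - y)) <= 72 * normc (x - y) ^+ 2.
Proof.
move=> hx hy; have [lx ex] := clog1pP hx; have [ly ey] := clog1pP hy.
have y1 : 127 / 128 <= normc (1 + y).
  have := normc_triangleB (1 + y) y; rewrite addrK normc_1; lra.
have y0 : 1 + y != 0 by rewrite -normc_gt0; lra.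
have -> : (1 + y)^-1 * (x - y) = cexp (clog1p x - clog1p y) - 1.
  apply: (mulfI y0); rewrite mulVKf // cexpB ex ey mulrBr mulrC divfK //; ring.
have hl := clog1p_lipschitz hx hy.
set l := clog1p x - clog1p y in hl *.
rewrite (normc_distC l); apply: (le_trans (normc_cexp_sub_id _)).
  by apply: (le_trans (normc_triangleB _ _)); lra.
have := normc_ge0 l; rewrite !expr2 => l0; nra.
Qed.

End LogarithmNearOne.

Section ComplexDifferentiability.
Variable R : realType.
Implicit Types (f g : C2 R -> R[i]) (u v : C2 R).

(** Frechet differentiability in epsilon-delta form, with real constants and with the derivative
    given by its partial derivatives [a] and [b]. The lemmas [differentiable_cdiff] and
    [cdiff_differentiable] translate from and to [differentiable]. *)
Definition cdiff_at f u (a b : R[i]) := forall e : R, 0 < e ->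
  exists2 d : R, 0 < d & forall v, norm1 (v - u) < d ->
    normc (f v - f u - (a * (v.1 - u.1) + b * (v.2 - u.2))) <= e * norm1 (v - u).

Definition linform (a b : R[i]) (h : C2 R) : R[i]^o := a * h.1 + b * h.2.

Lemma linform_is_linear a b : linear (linform a b).
Proof. by move=> k x y; rewrite /linform /= /GRing.scale /=; ring. Qed.

HB.instance Definition _ a b :=
  GRing.isLinear.Build R[i] (C2 R) R[i]^o _ (linform a b) (linform_is_linear a b).

Lemma linform_continuous a b : continuous (linform a b).
Proof.
move=> x; apply: (@cvgD _ R[i]^o).
- apply: (@cvgM R[i]); first exact: cvg_cst.
  exact: cvg_fst.
- apply: (@cvgM R[i]); first exact: cvg_cst.
  exact: cvg_snd.
Qed.

Lemma normC2_bounds (h : C2 R) :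
  `|h| <= (norm1 h)%:C%C /\ (norm1 h)%:C%C <= 2 * `|h|.
Proof.
have h1 := normc_ge0 h.1; have h2 := normc_ge0 h.2.
have -> : `|h| = (Num.max (normc h.1) (normc h.2))%:C%C.
  rewrite prod_normE !normC_normc /Num.max; case: ltP => hh.
    by rewrite ltcR hh.
  by rewrite ltcR ltNge hh.
have -> : 2 = (2%:R)%:C%C :> R[i] by rewrite rmorph_nat.
rewrite -rmorphM !lecR /norm1; case: (leP (normc h.1) (normc h.2)) => ?; lra.
Qed.

Lemma posC_real (e : R[i]) : 0 < e -> exists2 r : R, 0 < r & e = r%:C%C.
Proof.
move=> e0; have /complex_realP[r er] : e \is Num.real by exact: gtr0_real.
by exists r => //; rewrite -ltcR -er.
Qed.

Lemma nbhs_C2P u (P : C2 R -> Prop) :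
  (\near u, P u) <-> exists2 d : R, 0 < d & forall v, norm1 (v - u) < d -> P v.
Proof.
split.
- move=> /nbhs_normP[e /= /posC_real[r r0 ->] he]; exists r => // v hv.
  apply: he => /=; have [h1 _] := normC2_bounds (u - v).
  by apply: (le_lt_trans h1); rewrite ltcR norm1_distC.
- move=> [d d0 hd]; apply/nbhs_normP; exists (d / 2)%:C%C => /=.
    by rewrite ltcR; lra.
  move=> v /= hv; apply: hd; have [_ h2] := normC2_bounds (u - v).
  rewrite norm1_distC -ltcR; apply: (le_lt_trans h2).
  have -> : d%:C%C = 2 * (d / 2)%:C%C :> R[i].
    by rewrite -(rmorph_nat (real_complex R)) -rmorphM; congr (_ %:C)%C; field.
  by rewrite ltr_pM2l // ltr0n.
Qed.

Lemma differentiable_cdiff f u : differentiable (f : C2 R -> R[i]^o) u ->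
  exists a b, cdiff_at f u a b.
Proof.
move=> df; pose D := 'd (f : C2 R -> R[i]^o) u.
exists (D (1, 0)), (D (0, 1)) => e e0.
have lin (h : C2 R) : D h = D (1, 0) * h.1 + D (0, 1) * h.2.
  have -> : h = h.1 *: ((1, 0) : C2 R) + h.2 *: ((0, 1) : C2 R).
    by case: h => h1 h2; congr pair; rewrite /= /GRing.scale /= ?mulr1 ?mulr0 ?addr0 ?add0r.
  rewrite linearD !linearZ /= /GRing.scale /=; ring.
have e0' : 0 < (e / 2)%:C%C :> R[i] by rewrite ltcR; lra.
have /diff_locallyP[_ /eqaddoP/(_ _ e0')/nbhs_C2P[d d0 hd]] := df.
exists d => // v hv.
have /hd : norm1 (v - u - 0) < d by rewrite subr0.
have -> : ((f : C2 R -> R[i]^o) \o shift u - (cst (f u : R[i]^o) + D)) (v - u) =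
    f v - f u - (D (1, 0) * (v.1 - u.1) + D (0, 1) * (v.2 - u.2)) :> R[i]^o.
  by rewrite !fctE /= subrK lin opprD addrA.
move=> hle.
have [h1 h2] := normC2_bounds (v - u).
rewrite -lecR -normC_normc; apply: (le_trans hle).
have -> : (e * norm1 (v - u))%:C%C = (e / 2)%:C%C * (2 * (norm1 (v - u))%:C%C) :> R[i].
  by rewrite -(rmorph_nat (real_complex R)) -!rmorphM; congr (_ %:C)%C; field.
rewrite ler_pM2l //; apply: (le_trans h1).
by rewrite -(rmorph_nat (real_complex R)) -rmorphM lecR; have := norm1_ge0 (v - u); lra.
Qed.

Lemma cdiff_differentiable f u a b : cdiff_at f u a b ->
  differentiable (f : C2 R -> R[i]^o) u.
Proof.
move=> hf.
have key : (f : C2 R -> R[i]^o) \o shift u = cst (f u : R[i]^o) + linform a b +o_ (0 : C2 R) id.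
  apply/eqaddoP => _ /posC_real[e e0 ->]; apply/nbhs_C2P.
  have e20 : 0 < e / 2 by lra.
  have [d d0 hd] := hf _ e20.
  exists d => // h; rewrite subr0 => hh.
  have /hd : norm1 (h + u - u) < d by rewrite addrK.
  rewrite addrK /= !addrK => hle.
  rewrite !fctE /= opprD addrA normC_normc.
  have [h1 h2] := normC2_bounds h.
  apply: (@le_trans _ _ ((e / 2)%:C%C * (norm1 h)%:C%C)).
    by rewrite -rmorphM lecR.
  have -> : e%:C%C * `|h| = (e / 2)%:C%C * (2 * `|h|) :> R[i].
    rewrite mulrA; congr (_ * _).
    by rewrite -(rmorph_nat (real_complex R)) -!rmorphM; congr (_ %:C)%C; field.
  by rewrite ler_pM2l // ltcR.
have eD := diff_unique (@linform_continuous a b) key.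
by apply/diff_locallyP; rewrite eD; split => //; exact: linform_continuous.
Qed.

Lemma cdiff_lipschitz f u a b : cdiff_at f u a b ->
  exists L d : R, [/\ 0 < L, 0 < d & forall v, norm1 (v - u) < d ->
    normc (f v - f u) <= L * norm1 (v - u)].
Proof.
move=> /(_ 1 ltr01)[d d0 hd].
have a0 := normc_ge0 a; have b0 := normc_ge0 b.
exists (normc a + normc b + 1), d; split => //; first lra.
move=> v /hd; set w := a * _ + b * _ => h.
rewrite -(subrK w (f v - f u)); apply: (le_trans (normc_triangle _ _)).
have hw : normc w <= (normc a + normc b) * norm1 (v - u).
  apply: (le_trans (normc_triangle _ _)); rewrite !normcM mulrDl lerD //.
    by rewrite ler_wpM2l // lerDl normc_ge0.
  by rewrite ler_wpM2l // lerDr normc_ge0.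
lra.
Qed.

Lemma differentiable_near f u (e : R) : differentiable (f : C2 R -> R[i]^o) u ->
  0 < e -> exists2 d : R, 0 < d & forall v, norm1 (v - u) < d -> normc (f v - f u) < e.
Proof.
move=> /differentiable_cdiff[a [b /cdiff_lipschitz[L [d [L0 d0 h]]]]] e0.
exists (Num.min d (e / L)); first by rewrite lt_min d0 divr_gt0.
move=> v; rewrite lt_min => /andP[/h h1]; rewrite ltr_pdivlMr // mulrC.
exact: le_lt_trans.
Qed.

(** A chain rule for an outer function ([cexp] or [clog1p]) known only through a second order Taylor
    estimate along [f]: as [f] is Lipschitz at [u], the quadratic remainder is negligible against
    [norm1 (v - u)]. *)
Lemma differentiable_quadratic f g u (c : R[i]) (K : R) : 0 <= K ->
  differentiable (f : C2 R -> R[i]^o) u ->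
  (exists2 d : R, 0 < d & forall v, norm1 (v - u) < d ->
     normc (g v - g u - c * (f v - f u)) <= K * normc (f v - f u) ^+ 2) ->
  differentiable (g : C2 R -> R[i]^o) u.
Proof.
move=> K0 /differentiable_cdiff[a [b hf]] [d d0 hd].
have [L [d1 [L0 d10 hL]]] := cdiff_lipschitz hf.
have c0 := normc_ge0 c.
apply: (@cdiff_differentiable _ _ (c * a) (c * b)) => e e0.
have e1 : 0 < e / (2 * (normc c + 1)) by rewrite divr_gt0 //; lra.
have [d2 d20 h2] := hf _ e1.
pose d3 := e / (2 * (K * L ^+ 2 + 1)).
have KL : 0 <= K * L ^+ 2 by rewrite mulr_ge0 // sqr_ge0.
have d30 : 0 < d3 by rewrite divr_gt0 //; lra.
exists (Num.min (Num.min d d1) (Num.min d2 d3)); first by rewrite !lt_min d0 d10 d20.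
move=> v; rewrite !lt_min => /andP[/andP[/hd i1 /hL i2] /andP[/h2 i3 i4]].
set n := norm1 (v - u) in i1 i2 i3 i4 *; set w := a * _ + b * _ in i3.
have n0 : 0 <= n := norm1_ge0 _.
have -> : g v - g u - (c * a * (v - u).1 + c * b * (v - u).2) =
  (g v - g u - c * (f v - f u)) + c * (f v - f u - w).
  by rewrite /w /=; ring.
apply: (le_trans (normc_triangle _ _)); rewrite normcM.
have j1 : K * normc (f v - f u) ^+ 2 <= e / 2 * n.
  apply: (@le_trans _ _ (K * (L * n) ^+ 2)).
    by rewrite ler_wpM2l // ler_pXn2r ?nnegrE ?normc_ge0 // mulr_ge0 // ltW.
  rewrite exprMn (expr2 n) !mulrA ler_wpM2r //.
  have : d3 * (K * L ^+ 2 + 1) = e / 2.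
    by rewrite /d3; field; apply: lt0r_neq0; lra.
  nra.
have j2 : normc c * normc (f v - f u - w) <= e / 2 * n.
  apply: (@le_trans _ _ (normc c * (e / (2 * (normc c + 1)) * n))).
    by rewrite ler_wpM2l.
  rewrite mulrA ler_wpM2r //.
  have : e / (2 * (normc c + 1)) * (normc c + 1) = e / 2.
    by field; apply: lt0r_neq0; lra.
  nra.
lra.
Qed.

Lemma differentiable_cexp f u : differentiable (f : C2 R -> R[i]^o) u ->
  differentiable (fun v : C2 R => cexp (f v) : R[i]^o) u.
Proof.
move=> df; have M0 := normc_ge0 (cexp (f u)).
apply: (@differentiable_quadratic f _ u (cexp (f u)) (normc (cexp (f u)) * 8)) => //.
  by rewrite mulr_ge0.
have [d d0 hd] : exists2 d : R, 0 < d & forall v, norm1 (v - u) < d -> normc (f v - f u) < 1 / 2.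
  by apply: differentiable_near => //; lra.
exists d => // v /hd h.
have -> : cexp (f v) - cexp (f u) - cexp (f u) * (f v - f u) =
  cexp (f u) * (cexp (f v - f u) - 1 - (f v - f u)).
  by rewrite cexpB; field; exact: cexp_neq0.
by rewrite normcM -mulrA ler_wpM2l // normc_cexp_sub_id // ltW.
Qed.

Lemma differentiable_clog1p f u : differentiable (f : C2 R -> R[i]^o) u ->
  normc (f u) < 1 / 128 ->
  differentiable (fun v : C2 R => clog1p (f v) : R[i]^o) u.
Proof.
move=> df hu.
apply: (@differentiable_quadratic f _ u (1 + f u)^-1 72) => //.
have [d d0 hd] : exists2 d : R, 0 < d & forall v, norm1 (v - u) < d ->
    normc (f v - f u) < 1 / 128 - normc (f u).
  by apply: differentiable_near => //; lra.
exists d => // v /hd h; apply: clog1p_taylor; last exact: ltW.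
rewrite -(subrK (f u) (f v)); apply: (le_trans (normc_triangle _ _)); lra.
Qed.

(* The partial derivatives of the approximants form Cauchy sequences, as one sees
   by comparing increments along the two axes. *)
Lemma differentiable_lipschitz_approx f u :
  (forall e : R, 0 < e -> exists g, differentiable (g : C2 R -> R[i]^o) u /\
     exists2 d : R, 0 < d & forall v, norm1 (v - u) < d ->
       normc ((f v - g v) - (f u - g u)) <= e * norm1 (v - u)) ->
  differentiable (f : C2 R -> R[i]^o) u.
Proof.
move=> hf.
have app n : exists gab : (C2 R -> R[i]) * (R[i] * R[i]),
    cdiff_at gab.1 u gab.2.1 gab.2.2 /\
    exists2 d : R, 0 < d & forall v, norm1 (v - u) < d ->
      normc ((f v - gab.1 v) - (f u - gab.1 u)) <= 2^-1 ^+ n * norm1 (v - u).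
  have [g [/differentiable_cdiff[a [b hab]] hd]] := hf _ (half_pow_gt0 R n).
  by exists (g, (a, b)).
have {app}[G hG] := choice app.
pose L n (h : R[i] * R[i]) := (G n).2.1 * h.1 + (G n).2.2 * h.2.
have fL n e : 0 < e -> exists2 d : R, 0 < d & forall v, norm1 (v - u) < d ->
    normc (f v - f u - L n (v - u)) <= (2^-1 ^+ n + e) * norm1 (v - u).
  move=> e0; have [hab [d1 d10 h1]] := hG n; have [d2 d20 h2] := hab _ e0.
  exists (Num.min d1 d2); first by rewrite lt_min d10.
  move=> v; rewrite lt_min => /andP[/h1 i1 /h2 i2]; rewrite mulrDl.
  have -> : f v - f u - L n (v - u) =
    ((f v - (G n).1 v) - (f u - (G n).1 u)) + ((G n).1 v - (G n).1 u - L n (v - u)).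
    by ring.
  by apply: (le_trans (normc_triangle _ _)); exact: lerD.
have Lhom n (r : R) (h : R[i] * R[i]) : L n (r%:C%C * h.1, r%:C%C * h.2) = r%:C%C * L n h.
  by rewrite /L /=; ring.
(* Both [L n] and [L n.+1] approximate the increment of [f] from [u] to [u + r h] for small real
   [r]. They are homogeneous, so [r] cancels and the comparison holds for every [h]; the index [k]
   removes the remaining error. *)
have cmp n (h : R[i] * R[i]) : normc (L n.+1 h - L n h) <= 2 * 2^-1 ^+ n * norm1 h.
  apply: (@le_geometric_eps _ _ _ (2 * norm1 h)) => k.
  have [d1 d10 h1] := fL n _ (half_pow_gt0 R k).
  have [d2 d20 h2] := fL n.+1 _ (half_pow_gt0 R k).
  have nh := norm1_ge0 h.
  pose d := Num.min d1 d2; have d0 : 0 < d by rewrite lt_min d10.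
  pose r := d / 2 / (norm1 h + 1).
  have r0 : 0 < r by rewrite !divr_gt0 //; lra.
  pose rh : R[i] * R[i] := (r%:C%C * h.1, r%:C%C * h.2).
  have nrh : norm1 rh = r * norm1 h.
    by rewrite /norm1 /= !normcM normc_real ger0_norm ?ltW // mulrDr.
  have rd : norm1 (u + rh - u) < d.
    rewrite addrC addKr nrh.
    have : r * (norm1 h + 1) = d / 2 by rewrite /r; field; apply: lt0r_neq0; lra.
    nra.
  have /andP[rd1 rd2] : (norm1 (u + rh - u) < d1) && (norm1 (u + rh - u) < d2).
    by rewrite -lt_min.
  have := h1 _ rd1; have := h2 _ rd2.
  rewrite [u + rh - u]addrC addKr nrh /rh !Lhom.
  set D := f _ - f u => i2 i1.
  have : normc (r%:C%C * (L n.+1 h - L n h)) <=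
      (2^-1 ^+ n + 2^-1 ^+ k) * (r * norm1 h) + (2^-1 ^+ n.+1 + 2^-1 ^+ k) * (r * norm1 h).
    have -> : r%:C%C * (L n.+1 h - L n h) = (D - r%:C%C * L n h) - (D - r%:C%C * L n.+1 h).
      by ring.
    by apply: (le_trans (normc_triangleB _ _)); exact: lerD.
  rewrite normcM normc_real (ger0_norm (ltW r0)).
  move=> /le_trans i; rewrite -(ler_pM2l r0); apply: i; rewrite exprS.
  have : 0 <= 2^-1 ^+ n * (r * norm1 h).
    by apply: mulr_ge0; [exact: ltW (half_pow_gt0 _ _)|exact: mulr_ge0 (ltW r0) nh].
  lra.
have [a ha] : exists a, forall n, normc ((G n).2.1 - a) <= 4 * 2 * 2^-1 ^+ n.
  apply: complex_geometric_limit => n; have := cmp n (1, 0).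
  by rewrite /L /norm1 /= !mulr1 !mulr0 !addr0 normc_1 normc_0 addr0 mulr1.
have [b hb] : exists b, forall n, normc ((G n).2.2 - b) <= 4 * 2 * 2^-1 ^+ n.
  apply: complex_geometric_limit => n; have := cmp n (0, 1).
  by rewrite /L /norm1 /= !mulr1 !mulr0 !add0r normc_1 normc_0 add0r mulr1.
apply: (@cdiff_differentiable _ _ a b) => e e0.
have e10 : 0 < e / 32 by lra.
have [n hn] := half_pow_small e10.
have [d d0 hd] := fL n _ e10.
exists d => // v /hd h; set m := norm1 _ in h *; have m0 : 0 <= m := norm1_ge0 _.
have -> : f v - f u - (a * (v.1 - u.1) + b * (v.2 - u.2)) =
  (f v - f u - L n (v - u)) + (((G n).2.1 - a) * (v - u).1 + ((G n).2.2 - b) * (v - u).2).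
  by rewrite /L /=; ring.
apply: (le_trans (normc_triangle _ _)).
have : normc (((G n).2.1 - a) * (v - u).1 + ((G n).2.2 - b) * (v - u).2) <=
    8 * 2^-1 ^+ n * m.
  apply: (le_trans (normc_triangle _ _)); rewrite !normcM /m /norm1 mulrDr lerD //.
    by rewrite ler_wpM2r ?normc_ge0 //; have := ha n; lra.
  by rewrite ler_wpM2r ?normc_ge0 //; have := hb n; lra.
have : 0 <= e * m by rewrite mulr_ge0 // ltW.
have : 2^-1 ^+ n * m <= e / 32 * m by rewrite ler_wpM2r // ltW.
lra.
Qed.

(* The expansion bound makes the derivative injective, hence invertible, at [u]. *)
Lemma differentiable_inverse (F G : C2 R -> C2 R) u (K : R) :
  0 < K ->
  differentiable (fun x => (F x).1 : R[i]^o) u ->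
  differentiable (fun x => (F x).2 : R[i]^o) u ->
  (exists2 d : R, 0 < d & forall v, norm1 (v - u) < d ->
     norm1 (v - u) <= K * norm1 (F v - F u)) ->
  (exists2 d : R, 0 < d & forall y, norm1 (y - F u) < d ->
     F (G y) = y /\ norm1 (G y - u) <= K * norm1 (y - F u)) ->
  differentiable (fun y => (G y).1 : R[i]^o) (F u) /\
  differentiable (fun y => (G y).2 : R[i]^o) (F u).
Proof.
move=> K0 /differentiable_cdiff[a1 [b1 h1]] /differentiable_cdiff[a2 [b2 h2]] [d d0 hd] [d' d'0 hG].
pose A (h : R[i] * R[i]) : R[i] * R[i] := (a1 * h.1 + b1 * h.2, a2 * h.1 + b2 * h.2).
have FA e : 0 < e -> exists2 d : R, 0 < d & forall v, norm1 (v - u) < d ->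
    norm1 (F v - F u - A (v - u)) <= e * norm1 (v - u).
  move=> e0; have e20 : 0 < e / 2 by lra.
  have [d1 d10 i1] := h1 _ e20; have [d2 d20 i2] := h2 _ e20.
  exists (Num.min d1 d2); first by rewrite lt_min d10.
  move=> v; rewrite lt_min => /andP[/i1 j1 /i2 j2].
  by move: j1 j2; rewrite /norm1 /=; lra.
(* A nonzero kernel vector, scaled to length [d2 / 2], would move [F] by at most [d2 / (4 * K)],
   whereas the expansion bound demands at least [d2 / (2 * K)]. *)
have Ainj h : A h = 0 -> h = 0.
  move=> Ah; apply/eqP/negPn/negP => hn0.
  have nh : 0 < norm1 h.
    rewrite lt_neqAle norm1_ge0 andbT eq_sym; apply: contraNneq hn0 => nh0.
    by apply/eqP/norm1_eq0; rewrite nh0.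
  have e0 : 0 < 1 / (2 * K) by rewrite divr_gt0 //; lra.
  have [d1 d10 i1] := FA _ e0.
  pose d2 := Num.min d d1; have d20 : 0 < d2 by rewrite lt_min d0.
  pose r := d2 / 2 / norm1 h; have r0 : 0 < r by rewrite !divr_gt0 //; lra.
  pose rh : C2 R := (r%:C%C * h.1, r%:C%C * h.2).
  have nrh : norm1 rh = d2 / 2.
    rewrite /norm1 /= !normcM normc_real ger0_norm ?ltW // -mulrDr.
    by rewrite -/(norm1 h) /r divfK // lt0r_neq0.
  have Arh : A (u + rh - u) = 0.
    rewrite [u + rh]addrC addrK.
    have -> : A rh = (r%:C%C * (A h).1, r%:C%C * (A h).2) by congr pair; rewrite /=; ring.
    by rewrite Ah; congr pair; rewrite /= mulr0.
  have : norm1 (u + rh - u) < d2 by rewrite [u + rh]addrC addrK nrh; lra.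
  rewrite lt_min => /andP[/hd j1 /i1]; rewrite Arh subr0.
  move: j1; rewrite [u + rh - u]addrAC subrr add0r nrh => j1 j2.
  have : K * norm1 (F (u + rh) - F u) <= K * (1 / (2 * K) * (d2 / 2)) by rewrite ler_wpM2l // ltW.
  have -> : K * (1 / (2 * K) * (d2 / 2)) = d2 / 4 by field; exact: lt0r_neq0.
  lra.
pose D := a1 * b2 - b1 * a2.
(* [A] sends [(b1, - a1)] to [(0, - D)] and [(b2, - a2)] to [(D, 0)]. If [D] were 0, injectivity
   would make all four coefficients vanish, and [(1, 0)] would lie in the kernel. *)
have D0 : D != 0.
  apply/eqP => D0.
  have e1 : A (b1, - a1) = 0.
    congr pair; rewrite /=; first by ring.
    by apply: etrans (_ : - D = 0); [rewrite /D; ring|rewrite D0 oppr0].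
  have e2 : A (b2, - a2) = 0.
    congr pair; rewrite /=; last by ring.
    by apply: etrans D0; rewrite /D; ring.
  have [b10 /eqP] := Ainj _ e1; rewrite oppr_eq0 => /eqP a10.
  have [b20 /eqP] := Ainj _ e2; rewrite oppr_eq0 => /eqP a20.
  have [] : ((1, 0) : R[i] * R[i]) = 0.
    by apply: Ainj; congr pair; rewrite /= ?a10 ?a20 ?b10 ?b20 !mul0r addr0.
  by apply/eqP; rewrite oner_eq0.
have nD : 0 < normc D by rewrite normc_gt0.
have GFu : G (F u) = u.
  apply/eqP; rewrite -subr_eq0; apply/eqP/norm1_eq0.
  have [|_] := hG (F u); rewrite subrr norm10 ?mulr0 //.
(* This is the expansion of [F] at [u], taken at the point [G y], with the error measured by
   [y - F u] instead of [G y - u]. Cramer's rule then solves it for [G y - u]. *)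
have main e : 0 < e -> exists2 d : R, 0 < d & forall y, norm1 (y - F u) < d ->
    exists w : R[i] * R[i], norm1 w <= e * norm1 (y - F u) /\ y - F u = A (G y - u) + w.
  move=> e0; have eK : 0 < e / K by rewrite divr_gt0.
  have [d1 d10 i1] := FA _ eK.
  have dK : 0 < d1 / K by rewrite divr_gt0.
  exists (Num.min d' (d1 / K)); first by rewrite lt_min d'0.
  move=> y; rewrite lt_min => /andP[/hG[Fy Gy]].
  rewrite ltr_pdivlMr // mulrC => hy.
  exists (F (G y) - F u - A (G y - u)); split; last by rewrite Fy [RHS]addrC subrK.
  apply: (le_trans (i1 _ (le_lt_trans Gy hy))).
  have : e / K * norm1 (G y - u) <= e / K * (K * norm1 (y - F u)) by rewrite ler_wpM2l // ltW.
  by rewrite mulrA divfK // lt0r_neq0.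
have sum0 : 0 <= normc a1 + normc b1 + normc a2 + normc b2 by rewrite !addr_ge0 ?normc_ge0.
pose S := normc a1 + normc b1 + normc a2 + normc b2 + 1.
have S0 : 0 < S by rewrite /S; lra.
have bound (x y : R[i]) (w : R[i] * R[i]) (e n : R) : normc x <= S -> normc y <= S ->
    norm1 w <= e * normc D / S * n -> normc ((x * w.1 + y * w.2) / D) <= e * n.
  move=> xS yS hw; rewrite normc_div ler_pdivrMr //.
  apply: (le_trans (normc_triangle _ _)); rewrite !normcM.
  apply: (@le_trans _ _ (S * norm1 w)).
    by rewrite /norm1 mulrDr lerD // ler_wpM2r ?normc_ge0.
  have -> : e * n * normc D = S * (e * normc D / S * n) by field; exact: lt0r_neq0.
  by rewrite ler_wpM2l // ltW.
have ab : [/\ normc a1 <= S, normc b1 <= S, normc a2 <= S & normc b2 <= S].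
  have := normc_ge0 a1; have := normc_ge0 b1; have := normc_ge0 a2; have := normc_ge0 b2.
  by rewrite /S => *; split; lra.
have [a1S b1S a2S b2S] := ab.
split.
- apply: (@cdiff_differentiable _ _ (b2 / D) (- b1 / D)) => e e0.
  have e10 : 0 < e * normc D / S by rewrite divr_gt0 // mulr_gt0.
  have [d1 d10 i1] := main _ e10; exists d1 => // y /i1[w [wn wE]].
  have E1 : y.1 - (F u).1 = (A (G y - u)).1 + w.1 by rewrite -[LHS]/((y - F u).1) wE.
  have E2 : y.2 - (F u).2 = (A (G y - u)).2 + w.2 by rewrite -[LHS]/((y - F u).2) wE.
  rewrite GFu E1 E2.
  have -> : (G y).1 - u.1 - (b2 / D * ((A (G y - u)).1 + w.1) + - b1 / D * ((A (G y - u)).2 + w.2))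
     = (- b2 * w.1 + b1 * w.2) / D by rewrite /A /=; move: D0; rewrite /D => D0; field.
  by apply: bound => //; rewrite normc_opp.
- apply: (@cdiff_differentiable _ _ (- a2 / D) (a1 / D)) => e e0.
  have e10 : 0 < e * normc D / S by rewrite divr_gt0 // mulr_gt0.
  have [d1 d10 i1] := main _ e10; exists d1 => // y /i1[w [wn wE]].
  have E1 : y.1 - (F u).1 = (A (G y - u)).1 + w.1 by rewrite -[LHS]/((y - F u).1) wE.
  have E2 : y.2 - (F u).2 = (A (G y - u)).2 + w.2 by rewrite -[LHS]/((y - F u).2) wE.
  rewrite GFu E1 E2.
  have -> : (G y).2 - u.2 - (- a2 / D * ((A (G y - u)).1 + w.1) + a1 / D * ((A (G y - u)).2 + w.2))
     = (a2 * w.1 - a1 * w.2) / D by rewrite /A /=; move: D0; rewrite /D => D0; field.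
  by rewrite -mulNr; apply: bound => //; rewrite normc_opp.
Qed.

End ComplexDifferentiability.

(** * Sectors and decaying functions *)

Section LogarithmicShift.
Variable R : realType.
Implicit Types (u v : C2 R) (s t : R[i] * R[i]).

Definition logshift u s : C2 R := (u.1 * cexp s.1, u.2 * cexp s.2).

Lemma logshift0 u : logshift u 0 = u.
Proof. by case: u => z w; rewrite /logshift /= cexp0 !mulr1. Qed.

Lemma logshiftD u s t : logshift (logshift u s) t = logshift u (s + t).
Proof. by rewrite /logshift /= !cexpD !mulrA. Qed.

Lemma logshiftBK u s t : logshift (logshift u s) (t - s) = logshift u t.
Proof. by rewrite logshiftD addrC subrK. Qed.

(** Off the axes, additive and multiplicative increments are comparable: [s] consists of the
    logarithms of [1 + (v - u) / u], taken in each coordinate. The numbers 128 and 3 come from the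
    domain and the growth bound of [clog1p]. *)
Lemma logshift_local u : u.1 != 0 -> u.2 != 0 -> exists L d : R,
  [/\ 0 < L, 0 < d & forall v, norm1 (v - u) < d ->
     exists s, v = logshift u s /\ norm1 s <= L * norm1 (v - u)].
Proof.
move=> u1 u2; have n1 : 0 < normc u.1 by rewrite normc_gt0.
have n2 : 0 < normc u.2 by rewrite normc_gt0.
exists (3 / normc u.1 + 3 / normc u.2), (Num.min (normc u.1 / 128) (normc u.2 / 128)).
split; first by rewrite addr_gt0 // divr_gt0.
  by rewrite lt_min !divr_gt0.
move=> v; rewrite lt_min /norm1 => /andP[d1 d2].
have v1 := normc_ge0 (v - u).1; have v2 := normc_ge0 (v - u).2.
have q1 : normc ((v - u).1 / u.1) <= 1 / 128.
  by rewrite normc_div ler_pdivrMr //; lra.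
have q2 : normc ((v - u).2 / u.2) <= 1 / 128.
  by rewrite normc_div ler_pdivrMr //; lra.
exists (clog1p ((v - u).1 / u.1), clog1p ((v - u).2 / u.2)); split.
  rewrite /logshift /=.
  have [_ ->] := clog1pP q1; have [_ ->] := clog1pP q2.
  by case: v d1 d2 v1 v2 q1 q2 => *; congr pair; rewrite /=; field.
have h1 := clog1p_le q1; have h2 := clog1p_le q2; rewrite !normc_div in h1 h2.
apply: (le_trans (lerD h1 h2)).
set A := normc (v - u).1 in v1 *; set B := normc (v - u).2 in v2 *.
have i1 : 0 <= B * (normc u.1)^-1 by rewrite mulr_ge0 // invr_ge0 ltW.
have i2 : 0 <= A * (normc u.2)^-1 by rewrite mulr_ge0 // invr_ge0 ltW.
lra.
Qed.

Lemma logshift_dist u s : norm1 s <= 1 / 16 ->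
  norm1 (logshift u s - u) <= 2 * norm1 u * norm1 s.
Proof.
move=> hs; have s1 := normc_ge0 s.1; have s2 := normc_ge0 s.2.
have u1 := normc_ge0 u.1; have u2 := normc_ge0 u.2.
rewrite /norm1 in hs *.
have /andP[_ h1] : normc s.1 / 2 <= normc (cexp s.1 - 1) <= 2 * normc s.1.
  by apply: normc_cexp_sub1; lra.
have /andP[_ h2] : normc s.2 / 2 <= normc (cexp s.2 - 1) <= 2 * normc s.2.
  by apply: normc_cexp_sub1; lra.
rewrite /= -[in X in normc (X - u.1)](mulr1 u.1) -[in X in normc (X - u.2)](mulr1 u.2).
have -> : u.1 * 1 * cexp s.1 - u.1 = u.1 * (cexp s.1 - 1) by ring.
have -> : u.2 * 1 * cexp s.2 - u.2 = u.2 * (cexp s.2 - 1) by ring.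
rewrite !normcM.
have := ler_wpM2l u1 h1; have := ler_wpM2l u2 h2.
have := mulr_ge0 u1 s2; have := mulr_ge0 u2 s1; lra.
Qed.

End LogarithmicShift.

Section Sector.
Variables (R : realType) (l kap : R).
Hypotheses (l0 : 0 <= l) (kap0 : 0 <= kap).
Implicit Types (u v : C2 R) (s : R[i] * R[i]) (t : R).

Definition hgtA u : R := ln (normc u.2) - l * ln (normc u.1).
Definition hgtB u : R := ln (normc u.1) - kap * hgtA u.

Definition sector t : set (C2 R) :=
  [set u | [/\ u.1 != 0, u.2 != 0, t < hgtA u & t < hgtB u]].

Lemma sectorS t t' u : t <= t' -> sector t' u -> sector t u.
Proof.
by move=> tt [h1 h2 h3 h4]; split => //; exact: le_lt_trans tt _.
Qed.

Lemma ln_normc_mul_cexp (z s : R[i]) : z != 0 ->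
  ln (normc (z * cexp s)) = ln (normc z) + complex.Re s.
Proof.
by move=> z0; rewrite normcM normc_cexp lnM ?posrE ?expR_gt0 ?normc_gt0 // expRK.
Qed.

Lemma sector_logshift t u : sector t u ->
  exists2 d : R, 0 < d & forall s, norm1 s < d -> sector t (logshift u s).
Proof.
have [k0 l0'] : 0 <= kap /\ 0 <= l by [].
move=> [u1 u2 hA hB].
pose m := Num.min (hgtA u - t) (hgtB u - t).
have m0 : 0 < m by rewrite lt_min !subr_gt0 hA hB.
have [mA mB] : m <= hgtA u - t /\ m <= hgtB u - t by rewrite /m !ge_min !lexx orbT.
(* An increment [s] changes [hgtA] by at most [(1 + l) * norm1 s] and [hgtB] by at most
   [(1 + kap * (1 + l)) * norm1 s]; [K] dominates both factors. *)
pose K := 1 + (1 + kap) * (1 + l).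
have K0 : 0 < K by have := mulr_ge0 k0 l0'; rewrite /K; nra.
exists (m / K); first exact: divr_gt0.
move=> s; rewrite ltr_pdivlMr // => hs.
have [r1 _] := normc_ge_Re_Im s.1; have [r2 _] := normc_ge_Re_Im s.2.
have n1 := normc_ge0 s.1; have n2 := normc_ge0 s.2.
move: r1 r2; rewrite !ler_norml => /andP[r1 r1'] /andP[r2 r2'].
rewrite /norm1 /K in hs; set A := normc s.1 in r1 r1' n1 hs; set B := normc s.2 in r2 r2' n2 hs.
split; rewrite /= ?mulf_neq0 ?cexp_neq0 //.
- rewrite /hgtA /= !ln_normc_mul_cexp //.
  rewrite /hgtA in mA.
  have : l * complex.Re s.1 <= l * A by rewrite ler_wpM2l.
  have := mulr_ge0 l0 n2; have := mulr_ge0 kap0 n1; have := mulr_ge0 kap0 n2.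
  have := mulr_ge0 (mulr_ge0 kap0 l0) n1; have := mulr_ge0 (mulr_ge0 kap0 l0) n2.
  have := mulr_ge0 l0 n1; nra.
- rewrite /hgtB /hgtA /= !ln_normc_mul_cexp //.
  rewrite /hgtB /hgtA in mB.
  have : kap * complex.Re s.2 <= kap * B by rewrite ler_wpM2l.
  have : - (kap * l * A) <= kap * l * complex.Re s.1 by rewrite -mulrN ler_wpM2l // mulr_ge0.
  have := mulr_ge0 l0 n2; have := mulr_ge0 kap0 n1; have := mulr_ge0 kap0 n2.
  have := mulr_ge0 (mulr_ge0 kap0 l0) n1; have := mulr_ge0 (mulr_ge0 kap0 l0) n2.
  have := mulr_ge0 l0 n1; nra.
Qed.

Lemma sector_local t u : sector t u -> exists L d : R,
  [/\ 0 < L, 0 < d & forall v, norm1 (v - u) < d ->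
     exists s, [/\ v = logshift u s, norm1 s <= L * norm1 (v - u) & sector t v]].
Proof.
move=> su; have [u1 u2 _ _] := su.
have [L [d [L0 d0 hd]]] := logshift_local u1 u2.
have [e e0 he] := sector_logshift su.
exists L, (Num.min d (e / L)); split => //; first by rewrite lt_min d0 divr_gt0.
move=> v; rewrite lt_min => /andP[/hd[s [-> hs]]].
rewrite ltr_pdivlMr // mulrC => hv; exists s; split => //.
by apply: he; exact: le_lt_trans hs hv.
Qed.

(* Decay and Lipschitz bounds, the latter measured in logarithmic coordinates;
   they play the role that Cauchy estimates usually play. *)
Definition decay (c C t0 : R) (h : C2 R -> R[i]) := forall t, t0 <= t ->
  (forall u, sector t u -> normc (h u) <= C * expR (- (c * t))) /\
  (forall u s, sector t u -> sector t (logshift u s) ->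
     normc (h (logshift u s) - h u) <= C * expR (- (c * t)) * norm1 s).

Definition analytic t0 (h : C2 R -> R[i]) :=
  forall u, sector t0 u -> differentiable (h : C2 R -> R[i]^o) u.

Lemma decay_weaken c c' C C' t0 t0' h : 0 <= t0' -> t0 <= t0' -> 0 <= C -> c' <= c -> C <= C' ->
  decay c C t0 h -> decay c' C' t0' h.
Proof.
move=> t00 tt C0 cc CC hd t t0t.
have [h1 h2] := hd t (le_trans tt t0t).
have b : C * expR (- (c * t)) <= C' * expR (- (c' * t)).
  rewrite ler_pM ?expR_ge0 // ler_expR lerN2 ler_wpM2r //; exact: le_trans t0t.
split=> [u /h1 /le_trans|u s su ss]; first exact.
by apply: (le_trans (h2 _ _ su ss)); rewrite ler_wpM2r // norm1_ge0.
Qed.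

Lemma decayD c C C' t0 f g : decay c C t0 f -> decay c C' t0 g ->
  decay c (C + C') t0 (fun u => f u + g u).
Proof.
move=> df dg t t0t; have [f1 f2] := df t t0t; have [g1 g2] := dg t t0t.
rewrite mulrDl; split=> [u su|u s su ss].
  by apply: (le_trans (normc_triangle _ _)); rewrite lerD ?f1 ?g1.
rewrite opprD addrACA mulrDl.
by apply: (le_trans (normc_triangle _ _)); rewrite lerD ?f2 ?g2.
Qed.

Lemma decayZ c C t0 k f : decay c C t0 f ->
  decay c (normc k * C) t0 (fun u => k * f u).
Proof.
move=> df t t0t; have [f1 f2] := df t t0t.
split=> [u su|u s su ss]; rewrite -?mulrBr normcM -!mulrA ler_wpM2l ?normc_ge0 ?f1 //.
by rewrite mulrA f2.
Qed.

Lemma decay_clog1p c C t0 f : 0 <= c -> 0 <= C -> C * expR (- (c * t0)) <= 1 / 256 ->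
  decay c C t0 f -> decay c (3 * C) t0 (fun u => clog1p (f u)).
Proof.
move=> c0 C0 hC df t t0t; have [f1 f2] := df t t0t.
have small u : sector t u -> normc (f u) <= 1 / 128.
  move=> /f1 h; apply: (le_trans h); apply: (@le_trans _ _ (C * expR (- (c * t0)))); last by lra.
  by rewrite ler_wpM2l // ler_expR lerN2 ler_wpM2l.
split=> [u su|u s su ss].
  apply: (le_trans (clog1p_le (small _ su))); rewrite -mulrA ler_pM2l //; exact: f1.
apply: (le_trans (clog1p_lipschitz (small _ ss) (small _ su))).
by rewrite -!mulrA ler_pM2l // mulrA f2.
Qed.

(** The bound [1 / 256] keeps [f u] strictly inside the disc of radius [1 / 128], so that a
    neighbourhood is available for differentiating the logarithm. *)
Lemma analytic_clog1p c C t0 f : C * expR (- (c * t0)) <= 1 / 256 ->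
  decay c C t0 f -> analytic t0 f -> analytic t0 (fun u => clog1p (f u)).
Proof.
move=> hC df af u su; apply: differentiable_clog1p; first exact: af.
by have [f1 _] := df t0 (lexx _); apply: (le_lt_trans (f1 _ su)); lra.
Qed.

End Sector.

Section ScalarDifferentiability.
Variable R : realType.
Implicit Types (f g : C2 R -> R[i]) (u : C2 R).

Lemma differentiable_fst_C2 u : differentiable (fun v : C2 R => v.1 : R[i]^o) u.
Proof.
apply: (@cdiff_differentiable _ _ u 1 0) => e e0; exists 1 => // v _.
by rewrite mul1r mul0r addr0 subrr normc_0 mulr_ge0 ?norm1_ge0 // ltW.
Qed.

Lemma differentiable_snd_C2 u : differentiable (fun v : C2 R => v.2 : R[i]^o) u.
Proof.
apply: (@cdiff_differentiable _ _ u 0 1) => e e0; exists 1 => // v _.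
by rewrite mul1r mul0r add0r subrr normc_0 mulr_ge0 ?norm1_ge0 // ltW.
Qed.

Lemma differentiable_mul_C2 f g u : differentiable (f : C2 R -> R[i]^o) u ->
  differentiable (g : C2 R -> R[i]^o) u ->
  differentiable (fun v : C2 R => f v * g v : R[i]^o) u.
Proof. by move=> df dg; exact: (@differentiableM R[i] (C2 R) f g u). Qed.

Lemma differentiable_add_C2 f g u : differentiable (f : C2 R -> R[i]^o) u ->
  differentiable (g : C2 R -> R[i]^o) u ->
  differentiable (fun v : C2 R => f v + g v : R[i]^o) u.
Proof. by move=> df dg; exact: (@differentiableD R[i] (C2 R) R[i]^o f g u). Qed.

Lemma differentiable_pow_C2 f n u : differentiable (f : C2 R -> R[i]^o) u ->
  differentiable (fun v : C2 R => f v ^+ n : R[i]^o) u.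
Proof.
move=> df; elim: n => [|n IH].
  exact: (@differentiable_cst R[i] (C2 R) R[i]^o 1 u).
have -> : (fun v => f v ^+ n.+1) = (fun v => f v * f v ^+ n) :> (C2 R -> R[i]).
  by apply/funext => v; rewrite exprS.
exact: differentiable_mul_C2.
Qed.

Lemma differentiable_inv_C2 f u : f u != 0 -> differentiable (f : C2 R -> R[i]^o) u ->
  differentiable (fun v : C2 R => (f v)^-1 : R[i]^o) u.
Proof. by move=> f0 df; exact: (@differentiableV R[i] (C2 R) f u df f0). Qed.

Lemma differentiable_const_C2 (k : R[i]) u : differentiable (fun _ : C2 R => k : R[i]^o) u.
Proof. exact: (@differentiable_cst R[i] (C2 R) R[i]^o k u). Qed.

Lemma differentiable_comp_C2 (F : C2 R -> C2 R) g u :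
  differentiable (fun v => (F v).1 : R[i]^o) u ->
  differentiable (fun v => (F v).2 : R[i]^o) u ->
  differentiable (g : C2 R -> R[i]^o) (F u) ->
  differentiable (fun v : C2 R => g (F v) : R[i]^o) u.
Proof.
move=> d1 d2 dg.
suff dF : differentiable F u.
  exact: (@differentiable_comp R[i] (C2 R) (C2 R) R[i]^o F g u dF dg).
have -> : F = (fun v => ((F v).1, (F v).2)) by apply/funext => v; case: (F v).
exact: (@differentiable_pair R[i] (C2 R) R[i]^o R[i]^o _ _ u d1 d2).
Qed.

End ScalarDifferentiability.

Section Monomials.
Variables (R : realType) (l kap : R).

Definition monomial_ratio (k : R[i]) (i j gamma d : nat) (u : C2 R) : R[i] :=
  k * (u.1 ^+ i * u.2 ^+ j) / (u.1 ^+ gamma * u.2 ^+ d).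

Lemma monomial_ratioE b k (i j gamma d : nat) (u : C2 R) :
  b != 0 -> u.1 != 0 -> u.2 != 0 ->
  b * u.1 ^+ gamma * u.2 ^+ d * monomial_ratio (k / b) i j gamma d u = k * u.1 ^+ i * u.2 ^+ j.
Proof.
move=> b0 u1 u2; have := expf_neq0 gamma u1; have := expf_neq0 d u2.
rewrite /monomial_ratio; move: (u.1 ^+ gamma) (u.2 ^+ d) (u.1 ^+ i) (u.2 ^+ j).
by move=> x y z w y0 x0; field; rewrite ?b0 ?x0 ?y0.
Qed.

(* The ratio has modulus [normc k * exp (- (e1 * hgtB u + e2 * hgtA u))]. *)
Lemma decay_monomial_ratio k (i j gamma d : nat) (e1 e2 : R) :
  e1 = (gamma%:R - i%:R) + l * (d%:R - j%:R) ->
  e2 = kap * (gamma%:R - i%:R) + (1 + l * kap) * (d%:R - j%:R) ->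
  0 <= e1 -> 0 <= e2 -> 0 < e1 + e2 ->
  exists c C, [/\ 0 < c, 0 <= C, decay l kap c C 0 (monomial_ratio k i j gamma d) &
    analytic l kap 0 (monomial_ratio k i j gamma d)].
Proof.
move=> E1 E2 e10 e20 e120.
(* An increment [s] multiplies the ratio by [cexp nu] with [normc nu <= N / 32 * norm1 s]. The
   factor 32 covers two ranges: for [normc nu <= 1 / 16] the change is at most [2 * normc nu] times
   the size, and otherwise it is trivially at most twice the size bound, where
   [2 <= 32 * normc nu]. *)
pose N : R := 32 * (i%:R + j%:R + gamma%:R + d%:R + 1).
have [i0 j0 g0 d0] : [/\ 0 <= i%:R :> R, 0 <= j%:R :> R, 0 <= gamma%:R :> R & 0 <= d%:R :> R].
  by rewrite !ler0n.
have N32 : 32 <= N by rewrite /N; lra.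
have k0 := normc_ge0 k.
have size_le t u : 0 <= t -> sector l kap t u ->
    normc (monomial_ratio k i j gamma d u) <= normc k * expR (- ((e1 + e2) * t)).
  move=> t0 [u1 u2 hA hB].
  rewrite /monomial_ratio -mulrA normcM ler_wpM2l // normc_div !normcM !normc_X.
  rewrite -[normc u.1]lnK ?posrE ?normc_gt0 // -[normc u.2]lnK ?posrE ?normc_gt0 //.
  set x := ln (normc u.1) in hA hB *; set y := ln (normc u.2) in hA hB *.
  rewrite -!expRM_natl -!expRD -expRN -expRD ler_expR.
  have -> : i%:R * x + j%:R * y + - (gamma%:R * x + d%:R * y) =
            - (e1 * hgtB l kap u + e2 * hgtA l u).
    by rewrite E1 E2 /hgtB /hgtA -/x -/y; ring.
  have := ler_wpM2l e10 (ltW hB); have := ler_wpM2l e20 (ltW hA); lra.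
exists (e1 + e2), (N * normc k); split => //; first by rewrite mulr_ge0 //; lra.
- move=> t t0; split=> [u /(size_le _ _ t0) h|u s su ss].
    apply: (le_trans h); rewrite -mulrA ler_peMl ?mulr_ge0 ?expR_ge0 //; lra.
  pose nu := (i%:R * s.1 + j%:R * s.2) - (gamma%:R * s.1 + d%:R * s.2).
  have [u1 u2 _ _] := su.
  have E : monomial_ratio k i j gamma d (logshift u s) = monomial_ratio k i j gamma d u * cexp nu.
    rewrite /monomial_ratio /logshift /= cexpB !cexpD !cexp_natM !exprMn.
    have := cexp_neq0 s.1; have := cexp_neq0 s.2 => c2 c1.
    by field; rewrite !expf_neq0.
  have hnu : normc nu <= N / 32 * norm1 s.
    have s1 := normc_ge0 s.1; have s2 := normc_ge0 s.2.
    apply: (le_trans (normc_triangleB _ _)).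
    apply: (le_trans (lerD (normc_triangle _ _) (normc_triangle _ _))).
    rewrite !normcM !normc_nat /N /norm1.
    have := mulr_ge0 i0 s2; have := mulr_ge0 j0 s1; have := mulr_ge0 g0 s2; have := mulr_ge0 d0 s1.
    lra.
  have hu := size_le _ _ t0 su; have hs := size_le _ _ t0 ss.
  set M := normc k * expR _ in hu hs; have M0 : 0 <= M by rewrite mulr_ge0 ?expR_ge0.
  have -> : N * normc k * expR (- ((e1 + e2) * t)) * norm1 s = N * norm1 s * M.
    by rewrite /M; ring.
  have n0 := normc_ge0 nu.
  apply: (@le_trans _ _ (32 * normc nu * M)); last by rewrite ler_wpM2r //; lra.
  have [small|large] := leP (normc nu) (1 / 16).
    rewrite E -[in X in normc (X)](mulr1 (monomial_ratio k i j gamma d u)) -mulrA mul1r -mulrBr.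
    rewrite normcM mulrC.
    have /andP[_ h] := normc_cexp_sub1 small.
    by rewrite ler_pM ?normc_ge0 //; lra.
  apply: (le_trans (normc_triangleB _ _)).
  apply: (le_trans (lerD hs hu)).
  have : 1 / 16 * M <= normc nu * M by rewrite ler_wpM2r // ltW.
  lra.
- move=> u [u1 u2 _ _]; rewrite /monomial_ratio.
  apply: differentiable_mul_C2.
    apply: differentiable_mul_C2; first exact: differentiable_const_C2.
    apply: differentiable_mul_C2; apply: differentiable_pow_C2.
      exact: differentiable_fst_C2.
    exact: differentiable_snd_C2.
  apply: differentiable_inv_C2; first by rewrite mulf_neq0 // expf_neq0.
  apply: differentiable_mul_C2; apply: differentiable_pow_C2.
    exact: differentiable_fst_C2.
  exact: differentiable_snd_C2.
Qed.

End Monomials.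

(** * The linearizing series *)

Section LinearizingSeries.
Variables (R : realType) (l kap : R).
Hypotheses (l0 : 0 <= l) (kap0 : 0 <= kap).
Variables (F : C2 R -> C2 R) (t0 Lam K c : R).
Hypotheses (Lam0 : 0 <= Lam) (K1 : 1 <= K)
  (KLam : K * expR (- (c * Lam)) <= 2^-1).
Hypothesis F_sector : forall t u, t0 <= t ->
  sector l kap t u -> sector l kap (t + Lam) (F u).
Hypothesis F_logshift : forall u s,
  sector l kap t0 u -> sector l kap t0 (logshift u s) ->
  exists s', F (logshift u s) = logshift (F u) s' /\ norm1 s' <= K * norm1 s.
Hypotheses (F1_analytic : analytic l kap t0 (fun u => (F u).1))
  (F2_analytic : analytic l kap t0 (fun u => (F u).2)).

Let sec t := sector l kap t.

Lemma iter_sector n t u : t0 <= t -> sec t u -> sec (t + n%:R * Lam) (iter n F u).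
Proof.
move=> tt su; elim: n => [|n IH]; first by rewrite mul0r addr0.
rewrite iterS -natr1 mulrDl mul1r addrA; apply: F_sector => //.
by apply: (le_trans tt); rewrite lerDl mulr_ge0.
Qed.

Lemma iter_sector0 n t u : t0 <= t -> sec t u -> sec t (iter n F u).
Proof.
by move=> tt su; apply: sectorS (iter_sector n tt su); rewrite lerDl mulr_ge0.
Qed.

Lemma iter_logshift n u s : sec t0 u -> sec t0 (logshift u s) ->
  exists s', iter n F (logshift u s) = logshift (iter n F u) s' /\
             norm1 s' <= K ^+ n * norm1 s.
Proof.
move=> su ss; elim: n => [|n [s' [IH1 IH2]]]; first by exists s; rewrite mul1r.
have [] := @F_logshift (iter n F u) s'.
- exact: iter_sector0.
- by rewrite -IH1; exact: iter_sector0.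
move=> s'' [h1 h2]; exists s''; rewrite !iterS IH1; split => //.
apply: (le_trans h2); rewrite exprS -mulrA ler_wpM2l //.
by apply: le_trans K1.
Qed.

Lemma iter_analytic n : analytic l kap t0 (fun u => (iter n F u).1) /\
                        analytic l kap t0 (fun u => (iter n F u).2).
Proof.
elim: n => [|n [IH1 IH2]].
  by split=> u su; [exact: differentiable_fst_C2|exact: differentiable_snd_C2].
split=> u su.
- apply: (@differentiable_comp_C2 _ (iter n F) (fun v => (F v).1) u (IH1 u su) (IH2 u su)).
  by apply: F1_analytic; exact: iter_sector0.
- apply: (@differentiable_comp_C2 _ (iter n F) (fun v => (F v).2) u (IH1 u su) (IH2 u su)).
  by apply: F2_analytic; exact: iter_sector0.
Qed.

Lemma geometric_sum_le (a : nat -> R[i]) (M : R) n :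
  (forall k, normc (a k) <= M * 2^-1 ^+ k) ->
  normc (\sum_(k < n) a k) <= 2 * M - 2 * M * 2^-1 ^+ n.
Proof.
move=> ha; elim: n => [|n IH]; first by rewrite big_ord0 normc_0 expr0 mulr1 subrr.
rewrite big_ord_recr /=; apply: (le_trans (normc_triangle _ _)).
by rewrite exprS; have := ha n; lra.
Qed.

(** After [n] iterations the level has grown by [n%:R * Lam], so decay contributes
    [expR (- (c * Lam)) ^+ n], while increments have grown by at most [K ^+ n]. By [KLam] the
    product is at most [2^-1 ^+ n]; the negative powers of [sc] are merely bounded by 1. *)
Lemma linearizing_series (h : C2 R -> R[i]) (C : R) (sc : R[i]) :
  0 <= C -> 1 <= normc sc -> decay l kap c C t0 h -> analytic l kap t0 h ->
  exists E, [/\ decay l kap c (2 * C) t0 E, analytic l kap t0 E &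
    forall u, sec t0 u -> E (F u) = sc * E u - h u].
Proof.
move=> C0 sc1 hd ha.
have sc0 : sc != 0 by rewrite -normc_gt0; apply: lt_le_trans sc1.
pose a u n := (sc ^+ n.+1)^-1 * h (iter n F u).
have isc n : normc (sc ^+ n.+1)^-1 <= 1.
  by rewrite normcV normc_X invf_le1 ?exprn_gt0 ?exprn_ege1 //; apply: lt_le_trans sc1.
have eLam : expR (- (c * Lam)) <= 2^-1.
  by apply: le_trans KLam; rewrite ler_peMl // expR_ge0.
have esplit n t : expR (- (c * (t + n%:R * Lam))) = expR (- (c * t)) * expR (- (c * Lam)) ^+ n.
  by rewrite -expRM_natl -expRD; congr expR; ring.
have a_le n t u : t0 <= t -> sec t u -> normc (a u n) <= C * expR (- (c * t)) * 2^-1 ^+ n.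
  move=> tt su; rewrite normcM.
  have tn : t <= t + n%:R * Lam by rewrite lerDl mulr_ge0.
  have [+ _] := hd _ (le_trans tt tn).
  move=> /(_ _ (iter_sector n tt su)); rewrite esplit => hh.
  apply: (@le_trans _ _ (1 * (C * (expR (- (c * t)) * expR (- (c * Lam)) ^+ n)))).
    by rewrite ler_pM ?normc_ge0.
  rewrite mul1r -mulrA ler_wpM2l // ler_wpM2l ?expR_ge0 //.
  by rewrite lerXn2r ?nnegrE ?expR_ge0 ?invr_ge0.
have a_lip n t u s : t0 <= t -> sec t u -> sec t (logshift u s) ->
    normc (a (logshift u s) n - a u n) <= C * expR (- (c * t)) * norm1 s * 2^-1 ^+ n.
  move=> tt su ss; rewrite -mulrBr normcM.
  have [s' [e1 e2]] := iter_logshift n (sectorS tt su) (sectorS tt ss).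
  have tn : t <= t + n%:R * Lam by rewrite lerDl mulr_ge0.
  have [_ +] := hd _ (le_trans tt tn).
  move=> /(_ (iter n F u) s' (iter_sector n tt su)).
  rewrite -e1 => /(_ (iter_sector n tt ss)); rewrite esplit => hh.
  apply: (@le_trans _ _ (1 * (C * (expR (- (c * t)) * expR (- (c * Lam)) ^+ n) * norm1 s'))).
    by rewrite ler_pM ?normc_ge0.
  rewrite mul1r -[leRHS]mulrA -[leRHS]mulrA -[leLHS]mulrA ler_wpM2l // -mulrA ler_wpM2l ?expR_ge0 //.
  apply: (@le_trans _ _ (expR (- (c * Lam)) ^+ n * (K ^+ n * norm1 s))).
    by rewrite ler_wpM2l // exprn_ge0 // expR_ge0.
  rewrite mulrA -exprMn mulrC ler_wpM2l ?norm1_ge0 // mulrC.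
  by rewrite lerXn2r ?nnegrE ?mulr_ge0 ?expR_ge0 ?invr_ge0 // (le_trans _ K1).
pose S u n := \sum_(k < n) a u k.
(* The series is summed pointwise on the sector; elsewhere its value is arbitrary, so that [choice]
   can turn the limits into a function. *)
have hex u : exists e, sec t0 u -> forall n,
    normc (S u n - e) <= 4 * (C * expR (- (c * t0))) * 2^-1 ^+ n.
  have [su|nsu] := pselect (sec t0 u); last by exists 0.
  have [|e he] := @complex_geometric_limit _ (S u) (C * expR (- (c * t0))).
    by move=> n; rewrite /S big_ord_recr /= addrAC subrr add0r; exact: a_le.
  by exists e.
have [E hE] := choice hex.
(* The remainder after [N] terms has a Lipschitz constant proportional to [2^-1 ^+ N]. With [N = 0]
   this is the Lipschitz half of [decay] for [E]; with [N] large it makes the partial sums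
   approximate [E] in the sense of [differentiable_lipschitz_approx]. *)
have Elip t u s N : t0 <= t -> sec t u -> sec t (logshift u s) ->
    normc ((E (logshift u s) - S (logshift u s) N) - (E u - S u N))
      <= 2 * (C * expR (- (c * t)) * norm1 s) * 2^-1 ^+ N.
  move=> tt su ss; set M := C * _ * _; have M0 : 0 <= M.
    by rewrite !mulr_ge0 ?expR_ge0 ?norm1_ge0.
  have tail n : normc ((S (logshift u s) (N + n)%N - S u (N + n)%N) - (S (logshift u s) N - S u N))
      <= 2 * (M * 2^-1 ^+ N).
    rewrite /S !big_split_ord /=.
    set X := \sum_(i < N) a (logshift u s) _; set Y := \sum_(i < N) a u _.
    set X' := \sum_(i < n) _; set Y' := \sum_(i < n) _.
    have -> : X + X' - (Y + Y') - (X - Y) = X' - Y' by ring.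
    rewrite /X' /Y' -sumrB.
    have hk k : normc (a (logshift u s) (N + k)%N - a u (N + k)%N) <= M * 2^-1 ^+ N * 2^-1 ^+ k.
      by rewrite -mulrA -exprD; exact: a_lip.
    apply: (le_trans (geometric_sum_le n hk)); rewrite gerBl.
    have := mulr_ge0 (mulr_ge0 M0 (ltW (half_pow_gt0 R N))) (ltW (half_pow_gt0 R n)); lra.
  apply: (@le_geometric_eps _ _ _ (8 * (C * expR (- (c * t0))))) => n.
  have h1 := hE _ (sectorS tt su) (N + n)%N; have h2 := hE _ (sectorS tt ss) (N + n)%N.
  have -> : (E (logshift u s) - S (logshift u s) N) - (E u - S u N) =
     ((S (logshift u s) (N + n)%N - S u (N + n)%N) - (S (logshift u s) N - S u N))
     + ((S u (N + n)%N - E u) - (S (logshift u s) (N + n)%N - E (logshift u s))) by ring.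
  apply: (le_trans (normc_triangle _ _)).
  have := normc_triangleB (S u (N + n)%N - E u) (S (logshift u s) (N + n)%N - E (logshift u s)).
  have hN : C * expR (- (c * t0)) * 2^-1 ^+ (N + n) <= C * expR (- (c * t0)) * 2^-1 ^+ n.
    rewrite ler_wpM2l ?mulr_ge0 ?expR_ge0 // exprD ler_piMl ?(ltW (half_pow_gt0 _ _)) //.
    by rewrite exprn_ile1 // ?invr_ge0 // invf_le1 // ler1n.
  have := tail n; lra.
have Edecay : decay l kap c (2 * C) t0 E.
  move=> t tt; split=> [u su|u s su ss].
    apply: (@le_geometric_eps _ _ _ (4 * (C * expR (- (c * t0))))) => n.
    have h1 := hE _ (sectorS tt su) n.
    have h2 := geometric_sum_le n (fun k => a_le k t u tt su).
    have := normc_triangleB (S u n) (S u n - E u); rewrite opprB addrC subrK => h3.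
    have := mulr_ge0 (mulr_ge0 C0 (expR_ge0 (- (c * t)))) (ltW (half_pow_gt0 R n)).
    rewrite -/(S u n) in h2; lra.
  by have := Elip t u s 0%N tt su ss; rewrite /S !big_ord0 !subr0 expr0 mulr1 !mulrA.
have Sana n : analytic l kap t0 (fun u => S u n).
  move=> u su; elim: n => [|n IH].
    rewrite (_ : (fun u => S u 0%N) = fun=> 0); first exact: differentiable_const_C2.
    by apply/funext => v; rewrite /S big_ord0.
  rewrite (_ : (fun u => S u n.+1) = fun u => S u n + a u n); last first.
    by apply/funext => v; rewrite /S big_ord_recr.
  apply: differentiable_add_C2 => //; apply: differentiable_mul_C2.
    exact: differentiable_const_C2.
  have [i1 i2] := iter_analytic n.
  apply: (differentiable_comp_C2 (i1 u su) (i2 u su)).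
  by apply: ha; exact: iter_sector0.
exists E; split => //.
- move=> u su; apply: differentiable_lipschitz_approx => e e0.
  have [L [d [L0 d0 hd']]] := sector_local l0 kap0 su.
  pose M := 2 * (C * expR (- (c * t0)) * L).
  have M0 : 0 <= M by rewrite !mulr_ge0 ?expR_ge0 // ltW.
  have eM : 0 < e / (M + 1) by rewrite divr_gt0 //; lra.
  have [N hN] := half_pow_small eM.
  exists (fun v => S v N); split; first exact: Sana.
  exists d => // v /hd'[s [-> hs ss]].
  apply: (le_trans (Elip t0 u s N (lexx _) su ss)).
  set n := norm1 _ in hs *; set n' := norm1 (_ - u) in hs *.
  have n'0 : 0 <= n' := norm1_ge0 _.
  have p0 := ltW (half_pow_gt0 R N).
  apply: (@le_trans _ _ (M * 2^-1 ^+ N * n')).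
    rewrite /M -!mulrA ler_wpM2l // ler_wpM2l // ler_wpM2l ?expR_ge0 //.
    by rewrite mulrCA [n * _]mulrC ler_wpM2l.
  rewrite ler_wpM2r //.
  move: hN; rewrite ltr_pdivlMr; last by lra.
  by lra.
- move=> u su; apply/eqP; rewrite -subr_eq0; apply/eqP; apply: eq0_normc.
  apply/eqP; rewrite eq_le normc_ge0 andbT.
  apply: (@le_geometric_eps _ _ _ ((1 + normc sc) * (4 * (C * expR (- (c * t0)))))) => n.
  have sF : sec t0 (F u) by exact: (iter_sector0 1 (lexx _) su).
  (* Composition with [F] shifts the index by one: what is missing from [sc * S u n.+1] is its first
     term, [h u]. *)
  have SE : S (F u) n = sc * S u n.+1 - h u.
    rewrite /S big_ord_recl /= mulrDr /a expr1 mulrA divff // mul1r addrC addKr.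
    rewrite mulr_sumr; apply: eq_bigr => k _.
    rewrite /bump /= -iterS iterSr mulrA; congr (_ * _).
    by rewrite [in RHS]exprS invfM mulrA divff // mul1r.
  have -> : E (F u) - (sc * E u - h u) = sc * (S u n.+1 - E u) - (S (F u) n - E (F u)).
    by rewrite SE; ring.
  apply: (le_trans (normc_triangleB _ _)); rewrite normcM add0r.
  have h1 := hE _ sF n; have h2 := hE _ su n.+1.
  have := ler_wpM2l (normc_ge0 sc) h2; rewrite exprS.
  have := mulr_ge0 (normc_ge0 sc) (mulr_ge0 (mulr_ge0 C0 (expR_ge0 (- (c * t0)))) (ltW (half_pow_gt0 R n))).
  lra.
Qed.

End LinearizingSeries.

(** * Perturbations of the identity *)

Section PerturbedIdentity.
Variables (R : realType) (l kap : R).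
Hypotheses (l0 : 0 <= l) (kap0 : 0 <= kap).
Variables (E1 E2 : C2 R -> R[i]) (t0 : R).
Let sec := sector l kap t0.
Let phi (u : C2 R) : C2 R := logshift u (E1 u, E2 u).
Hypothesis E_lipschitz : forall u s, sec u -> sec (logshift u s) ->
  norm1 ((E1 (logshift u s), E2 (logshift u s)) - (E1 u, E2 u)) <= norm1 s / 2.
Hypotheses (E1_analytic : analytic l kap t0 E1) (E2_analytic : analytic l kap t0 E2).

Let E u : R[i] * R[i] := (E1 u, E2 u).

(** Undoing the shift of [phi v] by [E v] gives [s = t + (E u - E v)] explicitly, and the Lipschitz
    hypothesis gives [norm1 s <= norm1 t + norm1 s / 2]. No logarithm of a quotient is chosen, so
    [u] and [v] need not be close and the injectivity that follows (from [t = 0]) is global. *)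
Lemma perturbed_identity_expansive u v t : sec u -> sec v ->
  phi v = logshift (phi u) t -> exists s, v = logshift u s /\ norm1 s <= 2 * norm1 t.
Proof.
move=> su sv e; exists (t + (E u - E v)).
have ev : v = logshift u (t + (E u - E v)).
  have : logshift (phi v) (- E v) = logshift (logshift (phi u) t) (- E v) by rewrite e.
  by rewrite /phi -/(E u) -/(E v) !logshiftD subrr logshift0 addrCA.
split => //.
have := E_lipschitz su (_ : sec (logshift u (t + (E u - E v)))); rewrite -ev => /(_ sv) h.
have := norm1_triangle t (E u - E v).
by rewrite norm1_distC in h; move: h; rewrite /E; lra.
Qed.

Lemma perturbed_identity_inj u v : sec u -> sec v -> phi u = phi v -> u = v.
Proof.
move=> su sv e.
have [|s [-> ]] := @perturbed_identity_expansive u v 0 su sv; first by rewrite logshift0.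
rewrite norm10 mulr0 => /norm1_eq0 ->; by rewrite logshift0.
Qed.

Lemma perturbed_identity_analytic u : sec u ->
  differentiable (fun v => (phi v).1 : R[i]^o) u /\
  differentiable (fun v => (phi v).2 : R[i]^o) u.
Proof.
move=> su; split; apply: differentiable_mul_C2.
- exact: differentiable_fst_C2.
- by apply: differentiable_cexp; exact: E1_analytic.
- exact: differentiable_snd_C2.
- by apply: differentiable_cexp; exact: E2_analytic.
Qed.

Lemma phi_neq0 u : sec u -> (phi u).1 != 0 /\ (phi u).2 != 0.
Proof. by move=> [u1 u2 _ _]; rewrite /phi /= !mulf_neq0 ?cexp_neq0. Qed.

Lemma perturbed_identity_surj_near u : sec u ->
  exists2 d : R, 0 < d & forall y, norm1 (y - phi u) < d -> exists2 v, sec v & phi v = y.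
Proof.
move=> su; have [p1 p2] := phi_neq0 su.
have [rho rho0 hrho] := sector_logshift l0 kap0 su.
have [L [d [L0 d0 hd]]] := logshift_local p1 p2.
exists (Num.min d (rho / 4 / L)); first by rewrite lt_min d0 !divr_gt0.
move=> y; rewrite lt_min => /andP[/hd[t [-> ht]]].
rewrite ltr_pdivlMr // mulrC => hy.
pose r := rho / 2.
have in_sec s : norm1 s <= r -> sec (logshift u s).
  by move=> hs; apply: hrho; apply: (le_lt_trans hs); rewrite /r; lra.
(* With [y = logshift (phi u) t], the point [logshift u s] is sent to [y] once
   [s + E (logshift u s) = t + E u]: a fixed point equation with contraction factor 1/2. The bound
   on [t] is [rho / 4], half of the radius [r]. *)
pose Th s := t - (E (logshift u s) - E u).
have [||s s' hs hs'|s [hs es]] := @contraction_fixpoint R Th r.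
- by rewrite /r; lra.
- rewrite /Th logshift0 subrr subr0; apply: (le_trans ht); rewrite /r; lra.
- rewrite /Th.
  have -> : t - (E (logshift u s) - E u) - (t - (E (logshift u s') - E u)) =
    E (logshift u s') - E (logshift u s).
    by rewrite /E; congr pair; rewrite /=; ring.
  have := @E_lipschitz (logshift u s) (s' - s) (in_sec _ hs).
  rewrite logshiftBK => /(_ (in_sec _ hs')).
  by rewrite (norm1_distC s').
- exists (logshift u s); first exact: in_sec.
  rewrite /phi !logshiftD; congr logshift.
  rewrite -{1}es /Th -/(E (logshift u s)) -/(E u).
  by rewrite /E; congr pair; rewrite /=; ring.
Qed.

(** Only [phi v] is assumed close to [phi u], not [v] to [u], so this contains the continuity of the
    inverse. Closeness of the images gives a small [t], expansiveness an [s] of at most twice its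
    size, and [logshift_dist] a bound on [v - u]; the radius [1 / 16] of the latter explains
    [1 / 32]. *)
Lemma perturbed_identity_lower_bound u : sec u -> exists K d : R,
  [/\ 0 < K, 0 < d & forall v, sec v -> norm1 (phi v - phi u) < d ->
      norm1 (v - u) <= K * norm1 (phi v - phi u)].
Proof.
move=> su; have [p1 p2] := phi_neq0 su.
have [L [d [L0 d0 hd]]] := logshift_local p1 p2.
have u0 := norm1_ge0 u.
have K0 : 0 < 4 * (norm1 u + 1) * L by rewrite mulr_gt0 //; lra.
exists (4 * (norm1 u + 1) * L), (Num.min d (1 / 32 / L)); split => //.
  by rewrite lt_min d0 !divr_gt0.
move=> v sv; rewrite lt_min => /andP[/hd[t [et ht]]].
rewrite ltr_pdivlMr // mulrC => hy.
have [s [ev hs]] := perturbed_identity_expansive su sv et; subst v.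
have t_ge0 := norm1_ge0 t; have s_ge0 := norm1_ge0 s.
apply: (le_trans (logshift_dist u _)); first lra.
set n := norm1 (phi _ - _) in ht *.
have : norm1 u * norm1 s <= norm1 u * (2 * (L * n)) by rewrite ler_wpM2l //; lra.
have : 0 <= L * n by apply: le_trans ht.
lra.
Qed.

Lemma perturbed_identity_biholomorphic : biholomorphic_onto_image sec phi.
Proof.
split.
- move=> u su; have [d1 d2] := perturbed_identity_analytic su.
  exact: (@differentiable_pair R[i] (C2 R) R[i]^o R[i]^o _ _ u d1 d2).
- rewrite openE => _ [u su <-]; apply/nbhs_C2P.
  have [d d0 hd] := perturbed_identity_surj_near su.
  by exists d => // y /hd[v sv <-]; exists v.
have hpsi y : exists u, (phi @` sec) y -> sec u /\ phi u = y.
  have [[u su e]|no] := pselect ((phi @` sec) y); first by exists u.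
  by exists y.
have [psi hp] := choice hpsi.
have psiK u : sec u -> psi (phi u) = u.
  move=> su; have [|s1 s2] := hp (phi u); first by exists u.
  exact: perturbed_identity_inj.
exists psi; split => // _ [u su <-].
have [dp1 dp2] := perturbed_identity_analytic su.
have [K [d [K0 d0 hK]]] := perturbed_identity_lower_bound su.
have [d1 d10 h1] := perturbed_identity_surj_near su.
have [||i1 i2] := @differentiable_inverse R phi psi u K K0 dp1 dp2.
- have d20 : 0 < d / 2 by lra.
  have [e1 e10 j1] := differentiable_near dp1 d20.
  have [e2 e20 j2] := differentiable_near dp2 d20.
  have [L [e3 [_ e30 j3]]] := sector_local l0 kap0 su.
  exists (Num.min (Num.min e1 e2) e3); first by rewrite !lt_min e10 e20.
  move=> v; rewrite !lt_min => /andP[/andP[/j1 k1 /j2 k2] /j3[s [_ _ sv]]].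
  by apply: hK => //; move: k1 k2; rewrite /norm1 /=; lra.
- exists (Num.min d d1); first by rewrite lt_min d0.
  move=> y; rewrite lt_min => /andP[yd /h1[v sv e]].
  have [|s1 s2] := hp y; first by exists v.
  by split => //; have := hK _ s1; rewrite s2 => /(_ yd).
have -> : psi = (fun y => ((psi y).1, (psi y).2)) by apply/funext => y; case: (psi y).
exact: (@differentiable_pair R[i] (C2 R) R[i]^o R[i]^o _ _ (phi u) i1 i2).
Qed.

End PerturbedIdentity.

(** * Conjugacy in a sector *)

Section Conjugacy.
Variables (R : realType).

Lemma expR_decay_small (C c e : R) : 0 <= C -> 0 < c -> 0 < e ->
  exists2 T, 0 <= T & forall t, T <= t -> C * expR (- (c * t)) <= e.
Proof.
move=> C0 c0 e0; exists (C / (e * c)); first by rewrite divr_ge0 // mulr_ge0 // ltW.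
move=> t; rewrite ler_pdivrMr ?mulr_gt0 // => h.
rewrite expRN ler_pdivrMr ?expR_gt0 //.
have := expR_ge1Dx (c * t) => h1.
have : e * (1 + c * t) <= e * expR (c * t) by rewrite ler_wpM2l // ltW.
lra.
Qed.

Lemma normc_mul_cexp_sub_lt (z E : R[i]) (eps : R) : z != 0 -> 0 < eps ->
  normc E <= Num.min (1 / 16) (eps / 4) -> normc (z * cexp E - z) < eps * normc z.
Proof.
move=> z0 eps0; rewrite le_min => /andP[h16 heps].
have -> : z * cexp E - z = z * (cexp E - 1) by ring.
rewrite normcM mulrC ltr_pM2r ?normc_gt0 //.
have /andP[_ h] := normc_cexp_sub1 h16.
lra.
Qed.

Lemma ln_normc_X (z : R[i]) n : z != 0 -> ln (normc (z ^+ n)) = n%:R * ln (normc z).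
Proof.
move=> z0; rewrite normc_X.
by rewrite -{1}[normc z]lnK ?posrE ?normc_gt0 // -expRM_natl expRK.
Qed.

(** The heights of [v] are linear in those of [u] with nonnegative coefficients, so the lower bound
    [t] may be substituted for both. The constants [cA] and [cB] are the contributions of [a] and
    [b], while [2 + l] and [2 + kap * (1 + l)] absorb those of [x] and [y]. *)
Lemma sector_growth (l kap : R) (a b : R[i]) (delta gamma d : nat) (x y : R[i])
    (u v : C2 R) (t Lam : R) :
  0 <= l -> 0 <= kap -> a != 0 -> b != 0 ->
  v.1 = a * u.1 ^+ delta * cexp x -> v.2 = b * u.1 ^+ gamma * u.2 ^+ d * cexp y ->
  -1 <= complex.Re x <= 1 -> -1 <= complex.Re y <= 1 ->
  let e : R := gamma%:R + l * d%:R - l * delta%:R in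
  let cA := ln (normc b) - l * ln (normc a) in
  let cB := ln (normc a) - kap * cA in
  0 <= e -> 0 <= delta%:R - kap * e -> 0 <= kap * (delta%:R - kap * e - d%:R) ->
  Lam + `|cA| + 2 + l <= (e + d%:R + kap * e - 1) * t ->
  Lam + `|cB| + 2 + kap * (1 + l)
    <= (delta%:R - kap * e + kap * (delta%:R - kap * e - d%:R) - 1) * t ->
  sector l kap t u -> sector l kap (t + Lam) v.
Proof.
move=> l0 kap0 a0 b0 v1E v2E /andP[r1 r1'] /andP[r2 r2'] e cA cB e0 eB0 eB1 gA gB.
move=> [u1 u2 hA hB].
have x'E : ln (normc v.1) = ln (normc a) + delta%:R * ln (normc u.1) + complex.Re x.
  rewrite v1E ln_normc_mul_cexp ?mulf_neq0 ?expf_neq0 // normcM.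
  by rewrite lnM ?posrE ?normc_gt0 ?expf_neq0 // ln_normc_X.
have y'E : ln (normc v.2) = ln (normc b) + gamma%:R * ln (normc u.1) +
    d%:R * ln (normc u.2) + complex.Re y.
  rewrite v2E ln_normc_mul_cexp ?mulf_neq0 ?expf_neq0 // !normcM.
  by rewrite !lnM ?posrE ?mulr_gt0 ?normc_gt0 ?expf_neq0 // !ln_normc_X.
have fA : hgtA l v = e * hgtB l kap u + (d%:R + kap * e) * hgtA l u + cA
    + (complex.Re y - l * complex.Re x).
  by rewrite {1}/hgtA x'E y'E /hgtB /hgtA /e /cA; ring.
have fB : hgtB l kap v = (delta%:R - kap * e) * hgtB l kap u
    + kap * (delta%:R - kap * e - d%:R) * hgtA l u + cB
    + (complex.Re x - kap * (complex.Re y - l * complex.Re x)).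
  by rewrite {1}/hgtB fA x'E /hgtB /hgtA /e /cB; ring.
have := ler_norm (- cA); have := ler_norm (- cB); rewrite !normrN => nB nA.
split.
- by rewrite v1E !mulf_neq0 ?expf_neq0 ?cexp_neq0.
- by rewrite v2E !mulf_neq0 ?expf_neq0 ?cexp_neq0.
- rewrite fA; clear fA fB x'E y'E v1E v2E.
  have := ler_wpM2l l0 r1'; have := ler_wpM2l e0 (ltW hB).
  have de0 : 0 <= d%:R + kap * e by rewrite addr_ge0 // mulr_ge0.
  have := ler_wpM2l de0 (ltW hA); clearbody cB cA e; lra.
- rewrite fB; clear fA fB x'E y'E v1E v2E.
  have := ler_wpM2l (mulr_ge0 kap0 l0) r1; have := ler_wpM2l kap0 r2'.
  have := ler_wpM2l eB0 (ltW hB); have := ler_wpM2l eB1 (ltW hA).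
  clearbody cB cA e; lra.
Qed.

Lemma conjugacy_in_sector (l kap : R) (f : C2 R -> C2 R) (a b : R[i])
    (delta gamma d : nat) (zeta eta : C2 R -> R[i]) (cz Cz ce Ce : R) :
  0 <= l -> 0 <= kap -> a != 0 -> b != 0 -> (0 < delta)%N -> (0 < d)%N ->
  0 < cz -> 0 <= Cz -> decay l kap cz Cz 0 zeta -> analytic l kap 0 zeta ->
  0 < ce -> 0 <= Ce -> decay l kap ce Ce 0 eta -> analytic l kap 0 eta ->
  analytic l kap 0 (fun u => (f u).1) -> analytic l kap 0 (fun u => (f u).2) ->
  (forall u, sector l kap 0 u -> (f u).1 = a * u.1 ^+ delta * (1 + zeta u)) ->
  (forall u, sector l kap 0 u ->
     (f u).2 = b * u.1 ^+ gamma * u.2 ^+ d * (1 + eta u)) ->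
  let e : R := gamma%:R + l * d%:R - l * delta%:R in
  0 <= e -> 1 < e + d%:R + kap * e ->
  0 <= delta%:R - kap * e -> 0 <= kap * (delta%:R - kap * e - d%:R) ->
  1 < delta%:R - kap * e + kap * (delta%:R - kap * e - d%:R) ->
  exists2 t1 : R, 0 <= t1 & forall t, t1 <= t -> exists phi : C2 R -> C2 R,
    [/\ biholomorphic_onto_image (sector l kap t) phi,
        conjugates_on (sector l kap t) phi f
          (fun u => (a * u.1 ^+ delta, b * u.1 ^+ gamma * u.2 ^+ d)) &
        forall eps : R, 0 < eps -> exists2 T : R, t <= T &
          forall u, sector l kap T u ->
            normc ((phi u).1 - u.1) < eps * normc u.1 /\
            normc ((phi u).2 - u.2) < eps * normc u.2].
Proof.
move=> l0 kap0 a0 b0 delta0 d0 cz0 Cz0 dz az ce0 Ce0 de ae af1 af2 hf1 hf2 e e0 eA eB0 eB1 eB.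
pose c := Num.min cz ce; pose C := Cz + Ce.
have c0 : 0 < c by rewrite lt_min cz0.
have C0 : 0 <= C by rewrite addr_ge0.
have {}dz : decay l kap c C 0 zeta.
  by apply: decay_weaken dz => //; rewrite ?ge_min ?lexx // lerDl.
have {}de : decay l kap c C 0 eta.
  by apply: decay_weaken de => //; rewrite ?ge_min ?lexx ?orbT // lerDr.
(* [f] sends an increment [s] to [(delta s_1, gamma s_1 + d s_2)], up to the variations of the
   logarithms [Lz] and [Le]. Each of these is at most [norm1 s / 2], hence the final 1. *)
pose K : R := delta%:R + gamma%:R + d%:R + 1.
have [D0 G0 dd0] : [/\ 0 <= delta%:R :> R, 0 <= gamma%:R :> R & 0 <= d%:R :> R].
  by rewrite !ler0n.
have K1 : 1 <= K by rewrite lerDr !addr_ge0.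
(* [Lam] depends on [K] and [c] alone. The level [t0] is fixed afterwards, large enough for the
   logarithms to exist ([T0]) and for both heights to gain [Lam] ([qA] and [qB]). *)
have [Lam Lam0 hLam] : exists2 T, 0 <= T & forall t, T <= t -> K * expR (- (c * t)) <= 2^-1.
  by apply: expR_decay_small; rewrite // (le_trans _ K1).
have [T0 T00 hT0] : exists2 T, 0 <= T & forall t, T <= t -> C * expR (- (c * t)) <= 1 / 256.
  by apply: expR_decay_small; rewrite // divr_gt0.
pose cA := ln (normc b) - l * ln (normc a); pose cB := ln (normc a) - kap * cA.
pose sA := e + d%:R + kap * e - 1.
pose sB := delta%:R - kap * e + kap * (delta%:R - kap * e - d%:R) - 1.
have sA0 : 0 < sA by rewrite subr_gt0.
have sB0 : 0 < sB by rewrite subr_gt0.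
pose qA := (Lam + `|cA| + 2 + l) / sA; pose qB := (Lam + `|cB| + 2 + kap * (1 + l)) / sB.
have qA0 : 0 <= qA by rewrite divr_ge0 ?(ltW sA0) // !addr_ge0.
have qB0 : 0 <= qB by rewrite divr_ge0 ?(ltW sB0) // !addr_ge0 // mulr_ge0 // addr_ge0.
pose t0 := T0 + qA + qB.
have t00 : 0 <= t0 by rewrite !addr_ge0.
have T0t0 : T0 <= t0 by rewrite /t0 -addrA lerDl addr_ge0.
have growA t : t0 <= t -> Lam + `|cA| + 2 + l <= sA * t.
  move=> ht; rewrite mulrC -ler_pdivrMr //; apply: (le_trans _ ht).
  by rewrite -/qA /t0 addrAC lerDr addr_ge0.
have growB t : t0 <= t -> Lam + `|cB| + 2 + kap * (1 + l) <= sB * t.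
  move=> ht; rewrite [leRHS]mulrC -ler_pdivrMr //; apply: (le_trans _ ht).
  by rewrite -/qB /t0 lerDr addr_ge0.
have sm0 := hT0 _ T0t0.
pose Lz u := clog1p (zeta u); pose Le u := clog1p (eta u).
have dz0 : decay l kap c C t0 zeta by apply: decay_weaken dz.
have de0 : decay l kap c C t0 eta by apply: decay_weaken de.
have ana0 h : analytic l kap 0 h -> analytic l kap t0 h.
  by move=> ah u su; apply: ah; exact: sectorS su.
have dLz : decay l kap c (3 * C) t0 Lz by apply: decay_clog1p => //; exact: ltW.
have dLe : decay l kap c (3 * C) t0 Le by apply: decay_clog1p => //; exact: ltW.
have aLz : analytic l kap t0 Lz by apply: (analytic_clog1p sm0 dz0); exact: ana0.
have aLe : analytic l kap t0 Le by apply: (analytic_clog1p sm0 de0); exact: ana0.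
have eLz u : sector l kap t0 u -> cexp (Lz u) = 1 + zeta u.
  move=> su; apply: (clog1pP _).2; have [h _] := dz0 _ (lexx _).
  by apply: (le_trans (h _ su)); lra.
have eLe u : sector l kap t0 u -> cexp (Le u) = 1 + eta u.
  move=> su; apply: (clog1pP _).2; have [h _] := de0 _ (lexx _).
  by apply: (le_trans (h _ su)); lra.
have f1E u : sector l kap t0 u -> (f u).1 = a * u.1 ^+ delta * cexp (Lz u).
  by move=> su; rewrite eLz // hf1 //; exact: sectorS su.
have f2E u : sector l kap t0 u -> (f u).2 = b * u.1 ^+ gamma * u.2 ^+ d * cexp (Le u).
  by move=> su; rewrite eLe // hf2 //; exact: sectorS su.
have Lsmall (h : C2 R -> R[i]) u : decay l kap c (3 * C) t0 h -> sector l kap t0 u ->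
    -1 <= complex.Re (h u) <= 1.
  move=> dh su; rewrite -ler_norml; have [h1 _] := dh _ (lexx _).
  by have [r _] := normc_ge_Re_Im (h u); apply: (le_trans r); apply: (le_trans (h1 _ su)); lra.
have F_sector t u : t0 <= t -> sector l kap t u -> sector l kap (t + Lam) (f u).
  move=> tt su; have su0 := sectorS tt su.
  exact: (sector_growth l0 kap0 a0 b0 (f1E _ su0) (f2E _ su0) (Lsmall _ _ dLz su0)
    (Lsmall _ _ dLe su0) e0 eB0 eB1 (growA _ tt) (growB _ tt) su).
have Llip (h : C2 R -> R[i]) u s : decay l kap c (3 * C) t0 h -> sector l kap t0 u ->
    sector l kap t0 (logshift u s) -> normc (h (logshift u s) - h u) <= norm1 s / 2.
  move=> dh su ss; have [_ h2] := dh _ (lexx _); apply: (le_trans (h2 _ _ su ss)).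
  by rewrite mulrC ler_wpM2l ?norm1_ge0 //; lra.
have F_logshift u s : sector l kap t0 u -> sector l kap t0 (logshift u s) ->
    exists s', f (logshift u s) = logshift (f u) s' /\ norm1 s' <= K * norm1 s.
  move=> su ss.
  exists (delta%:R * s.1 + (Lz (logshift u s) - Lz u),
          gamma%:R * s.1 + d%:R * s.2 + (Le (logshift u s) - Le u)); split.
    have n1 := cexp_neq0 (Lz u); have n2 := cexp_neq0 (Le u).
    rewrite [LHS]surjective_pairing /logshift -/(logshift u s); congr pair; rewrite /=.
      rewrite f1E // f1E // /logshift /= -/(logshift u s) exprMn !cexpD cexpN cexp_natM.
      by field.
    rewrite f2E // f2E // /logshift /= -/(logshift u s) !exprMn !cexpD cexpN !cexp_natM.
    by field.
  have s1 := normc_ge0 s.1; have s2 := normc_ge0 s.2.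
  have h1 := Llip _ _ _ dLz su ss; have h2 := Llip _ _ _ dLe su ss.
  rewrite {1}/norm1 /=.
  apply: (le_trans (lerD (normc_triangle _ _) (normc_triangle _ _))).
  apply: (le_trans (lerD (lexx _) (lerD (normc_triangle _ _) (lexx _)))).
  rewrite !normcM !normc_nat /K; rewrite /norm1 in h1 h2 *.
  have := mulr_ge0 D0 s2; have := mulr_ge0 G0 s2; have := mulr_ge0 dd0 s1; lra.
have series := linearizing_series l0 kap0 Lam0 K1 (hLam _ (lexx _)) F_sector
  F_logshift (ana0 _ af1) (ana0 _ af2).
have C30 : 0 <= 3 * C by rewrite mulr_ge0.
have nat1 n : (0 < n)%N -> 1 <= normc (n%:R : R[i]) by rewrite normc_nat ler1n.
have [E1 [dE1 aE1 fE1]] := series Lz _ _ C30 (nat1 _ delta0) dLz aLz.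
(* The system is triangular: the equation for [E2] involves [E1], whose decay has just been obtained
   and now enters the right-hand side. *)
pose h2 u := Le u + - gamma%:R * E1 u.
have dh2 : decay l kap c (3 * C + normc (- gamma%:R : R[i]) * (2 * (3 * C))) t0 h2.
  by apply: decayD => //; exact: decayZ.
have ah2 : analytic l kap t0 h2.
  move=> u su; apply: differentiable_add_C2; first exact: aLe.
  by apply: differentiable_mul_C2; [exact: differentiable_const_C2|exact: aE1].
set C2' := 3 * C + _ in dh2.
have C2'0 : 0 <= C2' by rewrite addr_ge0 // !mulr_ge0 ?normc_ge0.
have [E2 [dE2 aE2 fE2]] := series h2 _ _ C2'0 (nat1 _ d0) dh2 ah2.
pose CE := 2 * (3 * C) + 2 * C2'.
have CE0 : 0 <= CE by rewrite addr_ge0 // mulr_ge0.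
have {}dE1 : decay l kap c CE t0 E1.
  by apply: decay_weaken dE1 => //; rewrite ?mulr_ge0 // lerDl mulr_ge0.
have {}dE2 : decay l kap c CE t0 E2.
  by apply: decay_weaken dE2 => //; rewrite ?mulr_ge0 // lerDr mulr_ge0.
(* A Lipschitz constant [1 / 4] for each of [E1] and [E2] adds up to the 1/2 required of a perturbed
   identity. *)
have [T1 T10 hT1] : exists2 T, 0 <= T & forall t, T <= t -> CE * expR (- (c * t)) <= 1 / 4.
  by apply: expR_decay_small; rewrite // divr_gt0.
exists (Num.max t0 T1); first by rewrite le_max t00.
move=> t; rewrite ge_max => /andP[t0t T1t].
pose phi (u : C2 R) : C2 R := logshift u (E1 u, E2 u).
exists phi; split.
- apply: perturbed_identity_biholomorphic => //.
  + move=> u s su ss; rewrite {1}/norm1 /=.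
    have [_ i1] := dE1 _ t0t; have [_ i2] := dE2 _ t0t.
    have := lerD (i1 _ _ su ss) (i2 _ _ su ss) => /le_trans; apply.
    have := ler_wpM2r (norm1_ge0 s) (hT1 _ T1t); lra.
  + by move=> u su; apply: aE1; exact: sectorS su.
  + by move=> u su; apply: aE2; exact: sectorS su.
- split=> [_ [u su <-]|u su].
    by apply: sectorS (F_sector _ _ t0t su); rewrite lerDl.
  have su0 := sectorS t0t su.
  have n1 := cexp_neq0 (Lz u); have n2 := cexp_neq0 (Le u); have n3 := cexp_neq0 (E1 u).
  rewrite /phi /logshift /=; congr pair.
    rewrite fE1 // f1E // cexpB cexp_natM exprMn; by field.
  rewrite fE2 // f2E // /h2 cexpB cexpD mulNr cexpN !cexp_natM !exprMn.
  by field; rewrite n2 expf_neq0.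
- move=> eps eps0.
  pose ep := Num.min (1 / 16) (eps / 4).
  have ep0 : 0 < ep by rewrite lt_min !divr_gt0.
  have [T T00' hT] : exists2 T, 0 <= T & forall t, T <= t -> CE * expR (- (c * t)) <= ep.
    exact: expR_decay_small.
  exists (Num.max t T); first by rewrite le_max lexx.
  move=> u su.
  have tT : t0 <= Num.max t T by rewrite le_max t0t.
  have TT : T <= Num.max t T by rewrite le_max lexx orbT.
  have [u1 u2 _ _] := su.
  have [i1 _] := dE1 _ tT; have [i2 _] := dE2 _ tT.
  have hep := hT _ TT.
  by split; apply: normc_mul_cexp_sub_lt => //; apply: le_trans hep; [exact: i1|exact: i2].
Qed.

End Conjugacy.

(** * The Newton polygon *)

Section NewtonPolygonGeometry.
Variables (R : realType) (q : {poly {poly R[i]}}) (V : seq (nat * nat)).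
Hypothesis newtonV : newton_vertices q V.
Implicit Types (v : nat * nat) (P : R^o * R^o).

Let point v : R^o * R^o := (v.1%:R, v.2%:R).
Let quadrants : set (R^o * R^o) := [set P | exists i j, q`_i`_j != 0 /\ lower_quadrant i j P].
Let NP : set (R^o * R^o) := newton_polygon q.

Lemma convex_setI (A : set (R^o * R^o)) :
  (forall x y (t : R), A x -> A y -> 0 <= t <= 1 -> A (t *: x + (1 - t) *: y)) ->
  @convex_set R (R^o * R^o)%type A.
Proof.
move=> hA x y t /set_mem Ax /set_mem Ay; apply/mem_set.
by apply: hA => //; apply/andP; split.
Qed.

Lemma newton_polygon_convex (x y : R^o * R^o) (t : R) :
  NP x -> NP y -> 0 < t < 1 -> NP (t *: x + (1 - t) *: y).
Proof.
move=> hx hy t01 M [cM sM].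
have Mx : M x by apply: hx. have My : M y by apply: hy.
have /andP[/ltW t0 /ltW t1] := t01.
have t01' : 0 <= t <= 1 by rewrite t0.
have := cM x y (Itv01 t0 t1) (mem_set Mx) (mem_set My).
by move=> /set_mem.
Qed.

Lemma newton_polygon_sub (A : set (R^o * R^o)) :
  (forall x y (t : R), A x -> A y -> 0 <= t <= 1 -> A (t *: x + (1 - t) *: y)) ->
  quadrants `<=` A -> NP `<=` A.
Proof. by move=> cA sA; apply: smallest_sub => //; exact: convex_setI. Qed.

Lemma quadrants_sub : quadrants `<=` NP.
Proof. exact: sub_gen_smallest. Qed.

(** If the vertex lies in a quadrant with corner [(i, j)], it is the midpoint of that corner and of
    its reflection, which is in the same quadrant; so it is the corner. If it lies in no quadrant,
    removing it from the hull leaves a convex set, by extremality, that still contains all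
    quadrants, against minimality. *)
Lemma vertex_support v : v \in V -> q`_(v.1)`_(v.2) != 0.
Proof.
move=> vV; have [_ /(_ (point v))[_ hv]] := newtonV.
have [NPv ext] : vertex NP (point v) by apply: hv; exists v.
have [qv|nqv] := pselect (quadrants (point v)).
  have [i [j [cij [/= li lj]]]] := qv.
  pose A : R^o * R^o := (i%:R, j%:R); pose B := 2 *: point v - A.
  have AN : NP A by apply: quadrants_sub; exists i, j; split => //; split.
  have BN : NP B.
    apply: quadrants_sub; exists i, j; split => //.
    by rewrite /B /point /A; split => /=; rewrite /GRing.scale /=; lra.
  have [||eA _] := ext A B (1 / 2) AN BN.
  - by apply/andP; split; lra.
  - by rewrite /B /A /point; congr pair; rewrite /= /GRing.scale /=; lra.
  by move: eA => [/eqP + /eqP]; rewrite !eqr_nat => /eqP <- /eqP <-.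
exfalso; have : (NP `\ point v) (point v); last by case=> _; exact.
have : NP `<=` NP `\ point v; last by exact.
apply: newton_polygon_sub.
  move=> x y t [Nx nx] [Ny ny] /andP[t0 t1].
  have [->|tn0] := eqVneq t 0.
    by rewrite scale0r add0r subr0 scale1r.
  have [->|tn1] := eqVneq t 1.
    by rewrite subrr scale0r addr0 scale1r.
  have t01 : 0 < t < 1 by rewrite !lt_neqAle t0 t1 tn1 eq_sym tn0.
  split; first exact: newton_polygon_convex.
  move=> /esym e; have [ex _] := ext x y t Nx Ny t01 e.
  exact: nx.
by move=> x qx; split; [exact: quadrants_sub|move=> e; apply: nqv; rewrite -e].
Qed.

(* A point on or below a chord is inside a vertical translate of the chord. *)
Lemma vertex_above_chord v A B : v \in V -> A \in V -> B \in V ->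
  (A.1 < v.1 < B.1)%N ->
  (B.1%:R - v.1%:R) * A.2%:R + (v.1%:R - A.1%:R) * B.2%:R
    < (B.1%:R - A.1%:R) * v.2%:R :> R.
Proof.
move=> vV AV BV; rewrite -!(ltr_nat R) => /andP[Av vB].
rewrite ltNge; apply/negP => below.
have [_ /(_ (point v))[_ hv]] := newtonV.
have [NPv ext] : vertex NP (point v) by apply: hv; exists v.
set x := v.1%:R : R in Av vB below *; set y := v.2%:R : R in below.
set x0 := A.1%:R : R in Av below *; set y0 := A.2%:R : R in below.
set x1 := B.1%:R : R in vB below *; set y1 := B.2%:R : R in below.
have w0 : 0 < x1 - x0 by lra.
pose t := (x1 - x) / (x1 - x0).
pose h := ((x1 - x) * y0 + (x - x0) * y1) / (x1 - x0) - y.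
have h0 : 0 <= h by rewrite subr_ge0 ler_pdivlMr // mulrC.
have t01 : 0 < t < 1.
  apply/andP; split; first by rewrite divr_gt0 // subr_gt0.
  by rewrite /t ltr_pdivrMr //; lra.
pose A' : R^o * R^o := (x0, y0 - h); pose B' : R^o * R^o := (x1, y1 - h).
have AN : NP A'.
  apply: quadrants_sub; exists A.1, A.2; split; first exact: vertex_support.
  by split => //=; rewrite -/y0; lra.
have BN : NP B'.
  apply: quadrants_sub; exists B.1, B.2; split; first exact: vertex_support.
  by split => //=; rewrite -/y1; lra.
have [|eA _] := ext A' B' t AN BN t01.
  rewrite /A' /B' /point; congr pair; rewrite /= /GRing.scale /= -/x -/y /h /t; field.
    by apply: lt0r_neq0.
  by apply: lt0r_neq0.
have : x0 = x by case: eA.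
by lra.
Qed.

(** One linear form may be maximal along a whole edge, so a second, independent form breaks ties.
    The lexicographic maximum over the finite support is extreme in the hull: the points that do not
    exceed it form a convex set [H], which contains the quadrants because the weights are
    nonnegative. This transfers maxima over the support to the list [V]. *)
Lemma support_lex_vertex (a b a' b' : R) : q != 0 ->
  0 <= a -> 0 <= b -> 0 <= a' -> 0 <= b' -> a * b' - a' * b != 0 ->
  exists2 v, v \in V & forall i j, q`_i`_j != 0 ->
    a * i%:R + b * j%:R <= a * v.1%:R + b * v.2%:R.
Proof.
move=> q0 a0 b0 a'0 b'0 det.
pose M := (\max_(i < size q) size (q`_i)%R)%N.
pose T := ('I_(size q) * 'I_M)%type.
have suppT i j : q`_i`_j != 0 -> exists x : T, i = x.1 /\ j = x.2.
  move=> cij.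
  have iq : (i < size q)%N.
    by rewrite ltnNge; apply: contraNN cij => h; rewrite (nth_default _ h) coef0.
  have jM : (j < M)%N.
    apply: (@leq_trans (size q`_i)).
      by rewrite ltnNge; apply: contraNN cij => h; rewrite (nth_default _ h).
    exact: (leq_bigmax (Ordinal iq)).
  by exists (Ordinal iq, Ordinal jM).
have [i0 [j0 c0]] : exists i j, q`_i`_j != 0.
  exists (size q).-1, (size (lead_coef q)).-1.
  by rewrite -/(lead_coef q) -/(lead_coef (lead_coef q)) !lead_coef_eq0.
have [x0 [ex1 ex2]] := suppT _ _ c0.
pose S (x : T) := q`_(x.1)`_(x.2) != 0.
have Sx0 : S x0 by rewrite /S -ex1 -ex2.
pose L (x : T) : R := a * (x.1 : nat)%:R + b * (x.2 : nat)%:R.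
pose L' (x : T) : R := a' * (x.1 : nat)%:R + b' * (x.2 : nat)%:R.
have [x1 Sx1 max1] := @arg_maxP _ R T x0 S L Sx0.
pose S' x := S x && (L x == L x1).
have S'x1 : S' x1 by rewrite /S' Sx1 eqxx.
have [x2 /andP[Sx2 /eqP Lx2] max2] := @arg_maxP _ R T x1 S' L' S'x1.
pose P := point (x2.1 : nat, x2.2 : nat).
pose f (Q : R^o * R^o) : R := a * Q.1 + b * Q.2.
pose f' (Q : R^o * R^o) : R := a' * Q.1 + b' * Q.2.
pose H : set (R^o * R^o) := [set Q | f Q < f P \/ (f Q = f P /\ f' Q <= f' P)].
have NH : NP `<=` H.
  apply: newton_polygon_sub.
    move=> x y t Hx Hy /andP[t0 t1].
    have fE (g1 g2 : R) : g1 * (t *: x + (1 - t) *: y).1 + g2 * (t *: x + (1 - t) *: y).2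
      = t * (g1 * x.1 + g2 * x.2) + (1 - t) * (g1 * y.1 + g2 * y.2).
      by rewrite /= /GRing.scale /=; ring.
    rewrite /H /= /f /f' !fE -/(f x) -/(f y) -/(f' x) -/(f' y) -/(f P) -/(f' P).
    case: Hx => [hx|[hx hx']]; case: Hy => [hy|[hy hy']].
    - left; have [->|tn] := eqVneq t 0; first by lra.
      have : 0 < t by rewrite lt_neqAle t0 eq_sym tn.
      by nra.
    - have [->|tn] := eqVneq t 0; first by right; split; lra.
      have tp : 0 < t by rewrite lt_neqAle t0 eq_sym tn.
      by left; rewrite hy; nra.
    - have [->|tn] := eqVneq t 1; first by right; split; lra.
      have tp : 0 < 1 - t by rewrite subr_gt0 lt_neqAle t1 tn.
      by left; rewrite hx; nra.
    - by right; split; [rewrite hx hy; ring|nra].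
  move=> Q [i [j [/[dup] cij /suppT[x [ei ej]] [Qi Qj]]]].
  have Sx : S x by move: cij; rewrite ei ej.
  have Lx : L x <= L x1 := max1 _ Sx.
  have fQ : f Q <= L x.
    by rewrite /f /L -ei -ej lerD // ler_wpM2l.
  have f'Q : f' Q <= L' x.
    by rewrite /f' /L' -ei -ej lerD // ler_wpM2l.
  have fP : f P = L x1 by rewrite -Lx2.
  have f'P : f' P = L' x2 by [].
  rewrite /H /=; have [lt|eqL] := ltP (f Q) (f P); [by left|right].
  have eL : L x = L x1 by apply/eqP; rewrite eq_le Lx /= -fP (le_trans eqL).
  split; first by apply/eqP; rewrite eq_le eqL andbT fP -eL.
  by rewrite f'P; apply: (le_trans f'Q); apply: max2; rewrite /S' Sx eL eqxx.
have PV : vertex NP P.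
  split; first by apply: quadrants_sub; exists x2.1, x2.2.
  move=> A B t NA NB /andP[t0 t1] e.
  have t1' : 0 < 1 - t by rewrite subr_gt0.
  have HA := NH _ NA; have HB := NH _ NB.
  have e1 : P.1 = t * A.1 + (1 - t) * B.1 by rewrite e.
  have e2 : P.2 = t * A.2 + (1 - t) * B.2 by rewrite e.
  have fe : f P = t * f A + (1 - t) * f B by rewrite /f e1 e2; ring.
  have fe' : f' P = t * f' A + (1 - t) * f' B by rewrite /f' e1 e2; ring.
  have [fA fB] : f A = f P /\ f B = f P.
    by case: HA => [hA|[hA _]]; case: HB => [hB|[hB _]]; split => //; exfalso; nra.
  have {HA}fA' : f' A <= f' P by case: HA => [|[]//]; rewrite fA ltxx.
  have {HB}fB' : f' B <= f' P by case: HB => [|[]//]; rewrite fB ltxx.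
  have [eA' eB'] : f' A = f' P /\ f' B = f' P.
    by split; apply/eqP; rewrite eq_le; apply/andP; split => //; nra.
  have uniq (Q : R^o * R^o) : f Q = f P -> f' Q = f' P -> Q = P.
    rewrite /f /f' => g1 g2.
    have d1 : (a * b' - a' * b) * (Q.1 - P.1) = 0.
      have -> : (a * b' - a' * b) * (Q.1 - P.1) = b' * ((a * Q.1 + b * Q.2) - (a * P.1 + b * P.2))
        - b * ((a' * Q.1 + b' * Q.2) - (a' * P.1 + b' * P.2)) by ring.
      by rewrite g1 g2 !subrr !mulr0 subr0.
    have d2 : (a * b' - a' * b) * (Q.2 - P.2) = 0.
      have -> : (a * b' - a' * b) * (Q.2 - P.2) = a * ((a' * Q.1 + b' * Q.2) - (a' * P.1 + b' * P.2))
        - a' * ((a * Q.1 + b * Q.2) - (a * P.1 + b * P.2)) by ring.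
      by rewrite g1 g2 !subrr !mulr0 subr0.
    move/eqP: d1; rewrite mulf_eq0 (negPf det) /= subr_eq0 => /eqP d1.
    move/eqP: d2; rewrite mulf_eq0 (negPf det) /= subr_eq0 => /eqP d2.
    by rewrite [LHS]surjective_pairing d1 d2.
  by split; exact: uniq.
have [_ /(_ P)[/(_ PV)[v vV ev] _]] := newtonV.
exists v => // i j /[dup] cij /suppT[x [ei ej]].
have Sx : S x by move: cij; rewrite ei ej.
have : L x <= L x1 := max1 _ Sx; rewrite -Lx2 /L -ei -ej.
have [-> ->] : (x2.1 : nat)%:R = v.1%:R :> R /\ (x2.2 : nat)%:R = v.2%:R :> R.
  by case: ev.
by [].
Qed.

Let vtx k := nth (0, 0)%N V k.

Lemma vertices_sorted j k : (j < k < size V)%N ->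
  ((vtx j).1 < (vtx k).1)%N /\ ((vtx k).2 < (vtx j).2)%N.
Proof.
have [sV _] := newtonV => /andP[jk kV].
have tr : transitive (fun v v' : nat * nat => (v.1 < v'.1)%N && (v'.2 < v.2)%N).
  move=> y x z /andP[h1 h2] /andP[h3 h4]; by rewrite (ltn_trans h1 h3) (ltn_trans h4 h2).
by have /andP[] := sorted_ltn_nth tr (0, 0)%N sV j k (ltn_trans jk kV) kV jk.
Qed.

Lemma vertices_coord k : (k.+1 < size V)%N ->
  vx R V k < vx R V k.+1 /\ vy R V k.+1 < vy R V k.
Proof.
by move=> h; rewrite !ltr_nat; apply: vertices_sorted; rewrite ltnSn.
Qed.

Lemma slope_gt0 k : (k.+1 < size V)%N -> 0 < slope R V k.
Proof.
by move=> /vertices_coord[h1 h2]; rewrite divr_gt0 ?subr_gt0.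
Qed.

Lemma slope_edge k : (k.+1 < size V)%N ->
  vx R V k + slope R V k * vy R V k = vx R V k.+1 + slope R V k * vy R V k.+1.
Proof.
move=> /vertices_coord[h1 h2]; rewrite /slope; field.
by rewrite subr_eq0 gt_eqF.
Qed.

(** The form [x + slope * y] is constant along the line of the edge, which meets the axis [x = 0] at
    height [intercept]. Comparisons of [delta] with the intercept thus become signs of growth
    coefficients. *)
Lemma slope_intercept k : (k.+1 < size V)%N ->
  slope R V k * intercept R V k = vx R V k + slope R V k * vy R V k.
Proof.
move=> /vertices_coord[h1 h2]; rewrite /slope /intercept; field.
by rewrite !subr_eq0 !gt_eqF.
Qed.

(** The middle one of three consecutive vertices lies strictly above the chord of its neighbours.
    This makes [l2] positive in the fourth case. *)
Lemma slope_decreasing k : (k.+2 < size V)%N -> slope R V k.+1 < slope R V k.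
Proof.
move=> h; have h' := ltnW h.
have [a1 a2] := vertices_coord h'; have [b1 b2] := vertices_coord h.
rewrite /slope ltr_pdivrMr ?subr_gt0 // mulrAC ltr_pdivlMr ?subr_gt0 //.
have := @vertex_above_chord (vtx k.+1) (vtx k) (vtx k.+2).
rewrite !mem_nth // ?(ltn_trans _ h') //.
have [c1 _] : ((vtx k).1 < (vtx k.+1).1)%N /\ ((vtx k.+1).2 < (vtx k).2)%N.
  by apply: vertices_sorted; rewrite ltnSn.
have [c2 _] : ((vtx k.+1).1 < (vtx k.+2).1)%N /\ ((vtx k.+2).2 < (vtx k.+1).2)%N.
  by apply: vertices_sorted; rewrite ltnSn.
rewrite c1 c2 => /(_ isT isT isT isT).
rewrite -/(vx R V k) -/(vy R V k) -/(vx R V k.+1) -/(vy R V k.+1) -/(vx R V k.+2) -/(vy R V k.+2).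
lra.
Qed.

(** The maximum of the form over the support is attained at some [v] in [V]. If [v] were strictly
    above the line of the edge, the chord from [v] to the far end of the edge would pass above the
    near end, against [vertex_above_chord]. *)
Lemma support_below_edge k i j : q != 0 -> (k.+1 < size V)%N -> q`_i`_j != 0 ->
  i%:R + slope R V k * j%:R <= vx R V k + slope R V k * vy R V k.
Proof.
move=> q0 hk cij; have l0 := slope_gt0 hk; set l := slope R V k in l0 *.
have [|v vV hv] := @support_lex_vertex 1 l 1 0 q0 ler01 (ltW l0) ler01 (lexx 0).
  by rewrite mulr0 mul1r sub0r oppr_eq0 lt0r_neq0.
have := hv _ _ cij; rewrite !mul1r => /le_trans; apply.
rewrite leNgt; apply/negP => big.
have edge := slope_edge hk; rewrite -/l in edge.
have kV := ltnW hk.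
have [m mV em] := nthP (0, 0)%N vV.
have [mk|] := ltnP m k.
  have := @vertex_above_chord (vtx k) (vtx m) (vtx k.+1).
  rewrite !mem_nth //.
  have [c1 _] : ((vtx m).1 < (vtx k).1)%N /\ ((vtx k).2 < (vtx m).2)%N.
  by apply: vertices_sorted; rewrite mk.
  have [c2 _] : ((vtx k).1 < (vtx k.+1).1)%N /\ ((vtx k.+1).2 < (vtx k).2)%N.
  by apply: vertices_sorted; rewrite ltnSn.
  rewrite c1 c2 => /(_ isT isT isT isT).
  rewrite /vtx em -/(vx R V k) -/(vy R V k) -/(vx R V k.+1) -/(vy R V k.+1).
  have [x1 _] := vertices_coord hk.
  rewrite -(ltr_pM2l l0); nra.
rewrite leq_eqVlt => /orP[/eqP e|km]; first by rewrite -em -e ltxx in big.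
move: km; rewrite leq_eqVlt => /orP[/eqP e|km].
  by rewrite -em -e edge ltxx in big.
have := @vertex_above_chord (vtx k.+1) (vtx k) (vtx m).
rewrite !mem_nth //.
have [c1 _] : ((vtx k).1 < (vtx k.+1).1)%N /\ ((vtx k.+1).2 < (vtx k).2)%N.
  by apply: vertices_sorted; rewrite ltnSn.
have [c2 _] : ((vtx k.+1).1 < (vtx m).1)%N /\ ((vtx m).2 < (vtx k.+1).2)%N.
  by apply: vertices_sorted; rewrite km.
rewrite c1 c2 => /(_ isT isT isT isT).
rewrite /vtx em -/(vx R V k) -/(vy R V k) -/(vx R V k.+1) -/(vy R V k.+1).
have [x1 _] := vertices_coord hk.
rewrite -(ltr_pM2l l0); nra.
Qed.

Lemma support_below_first i j : q != 0 -> q`_i`_j != 0 -> j%:R <= vy R V 0.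
Proof.
move=> q0 cij.
have [|v vV hv] := @support_lex_vertex 0 1 1 0 q0 (lexx 0) ler01 ler01 (lexx 0).
  by rewrite mulr0 mul1r sub0r oppr_eq0 oner_eq0.
have := hv _ _ cij; rewrite !mul0r !mul1r !add0r => /le_trans; apply.
have [[|m] mV <-] := nthP (0, 0)%N vV; first by [].
by rewrite ler_nat ltnW //; have [] := @vertices_sorted 0 m.+1.
Qed.

Lemma support_left_of_last i j : q != 0 -> q`_i`_j != 0 -> i%:R <= vx R V (size V).-1.
Proof.
move=> q0 cij.
have [|v vV hv] := @support_lex_vertex 1 0 0 1 q0 ler01 (lexx 0) (lexx 0) ler01.
  by rewrite mul0r mulr1 subr0 oner_eq0.
have := hv _ _ cij; rewrite !mul0r !mul1r !addr0 => /le_trans; apply.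
have [m mV <-] := nthP (0, 0)%N vV.
have V0 : (0 < size V)%N by apply: leq_ltn_trans mV.
have : (m <= (size V).-1)%N by rewrite -ltnS prednK.
rewrite leq_eqVlt => /orP[/eqP->//|hm].
have [h _] : ((vtx m).1 < (vtx (size V).-1).1)%N /\ ((vtx (size V).-1).2 < (vtx m).2)%N.
  by apply: vertices_sorted; rewrite hm prednK /=.
by rewrite ler_nat ltnW.
Qed.

End NewtonPolygonGeometry.

(** * The regions of the four cases *)

Section Regions.
Variable R : realType.
Implicit Types (z w : R[i]) (r l k : R).

Lemma lt_normc_ln r z : 0 < r -> r < normc z <-> z != 0 /\ ln r < ln (normc z).
Proof.
move=> r0; split=> [h|[z0]].
  have n0 : 0 < normc z by apply: lt_trans h.
  by rewrite -normc_gt0 n0 ltr_ln ?posrE.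
by rewrite ltr_ln ?posrE ?normc_gt0.
Qed.

Lemma lt_powR_normc_ln r l z w : 0 < r -> z != 0 ->
  r * normc z `^ l < normc w <-> w != 0 /\ ln r < ln (normc w) - l * ln (normc z).
Proof.
move=> r0 z0; have n0 : 0 < normc z by rewrite normc_gt0.
have p0 : 0 < r * normc z `^ l by rewrite mulr_gt0 // powR_gt0.
rewrite lt_normc_ln // lnM ?posrE ?powR_gt0 // ln_powR.
by rewrite ltrBrDr.
Qed.

(** Since 0 to a power [k != 0] is 0, the strict inequality itself excludes [z = 0]; this matters in
    the regions that have no explicit lower bound on [normc z]. *)
Lemma normc_powR_lt_ln r l k z w : 0 < r -> 0 < l -> k != 0 -> w != 0 ->
  normc w < r `^ (- l) * normc z `^ k <->
  z != 0 /\ ln r < (k / l) * ln (normc z) - ln (normc w) / l.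
Proof.
move=> r0 l0 k0 w0; have nw : 0 < normc w by rewrite normc_gt0.
have [->|z0] := eqVneq z 0.
  by rewrite normc_0 powR0 // mulr0; split=> [|[]//]; rewrite ltNge normc_ge0.
have nz : 0 < normc z by rewrite normc_gt0.
have -> : (normc w < r `^ (- l) * normc z `^ k) =
    (ln (normc w) < - l * ln r + k * ln (normc z)).
  by rewrite -!ln_powR -lnM ?posrE ?powR_gt0 // ltr_ln // posrE mulr_gt0 // powR_gt0.
rewrite -(ltr_pM2l l0 (ln r)).
have -> : l * (k / l * ln (normc z) - ln (normc w) / l) = k * ln (normc z) - ln (normc w).
  by field; exact: lt0r_neq0.
by split=> [h|[_ h]]; [split=> //|]; lra.
Qed.

End Regions.

Lemma total_degree_support (R : realType) (q : {poly {poly R[i]}}) n :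
  (0 < n <= total_degree q)%N -> exists i j, q`_i`_j != 0 /\ (n <= i + j)%N.
Proof.
move=> /andP[n0 h]; apply: contrapT => no.
have : (total_degree q <= n.-1)%N.
  apply/bigmax_leqP => i _; apply/bigmax_leqP => j cij.
  rewrite -ltnS prednK // ltnNge; apply/negP => hij; apply: no.
  by exists i, j.
by rewrite leqNgt prednK // h.
Qed.

(** Here [l] is the slope of the edge that starts at [(gamma, d)] and [kap] the inverse of l_2, each
    being 0 when the corresponding edge is missing. The two inequalities on [(i, j)] place the
    support below the edge that starts at the vertex and, up to the factor [kap], below the one that
    ends there; for a missing edge they reduce to [i <= gamma], respectively [j <= d]. *)
Lemma newton_sector (R : realType) (q : {poly {poly R[i]}}) (V : seq (nat * nat))
    (delta gamma d : nat) (U : R -> set (C2 R)) :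
  newton_vertices q V -> (2 <= delta)%N -> (2 <= total_degree q)%N ->
  skew_case V delta gamma d U ->
  (2 <= d)%N \/ (d = 1%N /\
     forall k, (k.+1 < size V)%N -> delta%:R <> intercept R V k) ->
  exists l kap : R, let e := gamma%:R + l * d%:R - l * delta%:R in
  [/\ 0 <= l /\ 0 <= kap,
      forall r, 0 < r -> U r = sector l kap (ln r),
      q`_gamma`_d != 0,
      forall i j, q`_i`_j != 0 ->
        0 <= (gamma%:R - i%:R) + l * (d%:R - j%:R) :> R /\
        0 <= kap * (gamma%:R - i%:R) + (1 + l * kap) * (d%:R - j%:R) &
      [/\ 0 <= e, 1 < e + d%:R + kap * e, 0 <= delta%:R - kap * e,
        0 <= kap * (delta%:R - kap * e - d%:R) &
        1 < delta%:R - kap * e + kap * (delta%:R - kap * e - d%:R)]].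
Proof.
move=> hV delta2 deg2 hU hd.
have [i0 [j0 [c0 ij0]]] : exists i j, q`_i`_j != 0 /\ (2 <= i + j)%N.
  by apply: total_degree_support; rewrite deg2.
have q0 : q != 0 by apply: contraNneq c0 => ->; rewrite !coef0.
have D2 : 2 <= delta%:R :> R by rewrite ler_nat.
have d1 : 1 <= d%:R :> R.
  by rewrite ler1n; case: hd => [|[-> //]]; exact: leq_trans.
have dcase : 2 <= d%:R :> R \/
    d%:R = 1 :> R /\ forall k, (k.+1 < size V)%N -> delta%:R <> intercept R V k.
  by case: hd => [h|[-> h]]; [left; rewrite ler_nat|right].
have g0 : 0 <= gamma%:R :> R by rewrite ler0n.
case: hU dcase d1 g0 => {hd U gamma d}.
- move=> gamma d sV eV dcase d1 g0.
  have vV : (gamma, d) \in V by rewrite -eV mem_nth // sV.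
  have iV i j : q`_i`_j != 0 -> i%:R <= gamma%:R :> R /\ j%:R <= d%:R :> R.
    move=> cij; split.
      by have := support_left_of_last hV q0 cij; rewrite sV /vx eV.
    by have := support_below_first hV q0 cij; rewrite /vy eV.
  (* With a single vertex the first height grows by the factor [gamma + d]. It is at least 2 even
     for [d = 1], since a monomial of total degree at least 2 has exponents bounded by [gamma] and
     [d]. *)
  have [hi hj] := iV _ _ c0.
  have ij2 : 2 <= i0%:R + j0%:R :> R by rewrite -natrD ler_nat.
  exists 0, 0; split => //.
  + move=> r r0; apply/seteqP; split=> u; rewrite /sector /hgtB /hgtA /= !mul0r !subr0.
      by move=> [/(lt_normc_ln _ r0)[h1 h2] /(lt_normc_ln _ r0)[h3 h4]].
    by move=> [h1 h2 h3 h4]; split; apply/lt_normc_ln.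
  + exact: (vertex_support hV vV).
  + by move=> i j /iV[hi' hj']; split; lra.
  + by split; lra.
- move=> gamma d l1 sV dT eV ->.
  have vV : (gamma, d) \in V by rewrite -eV mem_nth // (leq_trans _ sV).
  move=> dcase d1 g0.
  have l0 := slope_gt0 hV sV; have lT := slope_intercept hV sV.
  have gE : vx R V 0 = gamma%:R by rewrite /vx eV.
  have dE : vy R V 0 = d%:R by rewrite /vy eV.
  rewrite gE dE in lT; set l := slope R V 0 in l0 lT *.
  have lTd : 0 <= l * (intercept R V 0 - delta%:R) by rewrite mulr_ge0 ?subr_ge0 // ltW.
  exists l, 0; split => //; first by split => //; exact: ltW.
  + move=> r r0; apply/seteqP; split=> u; rewrite /sector /hgtB /= !mul0r !subr0.
      move=> [/(lt_normc_ln _ r0)[h1 h2]].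
      by move=> /(lt_powR_normc_ln _ _ r0 h1)[h3 h4].
    move=> [h1 h2 h3 h4]; split; first exact/lt_normc_ln.
    exact/lt_powR_normc_ln.
  + exact: (vertex_support hV vV).
  + move=> i j cij.
    have := support_below_edge hV q0 sV cij; rewrite gE dE -/l => h1.
    have := support_below_first hV q0 cij; rewrite dE => h2.
    by split; lra.
  + split; [lra| |lra|lra|lra].
    case: dcase => [d2|[dd hT]]; first by lra.
    have ne : intercept R V 0 != delta%:R by apply/eqP => /esym; exact: hT.
    have : 0 < l * (intercept R V 0 - delta%:R).
      by rewrite mulr_gt0 // subr_gt0 lt_neqAle eq_sym ne.
    lra.
- move=> k gamma d l2 sV Td eV ->.
  have sV' : (k.+1 < size V)%N by rewrite sV.
  have vV : (gamma, d) \in V by rewrite -eV mem_nth.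
  move=> dcase d1 g0.
  have l0 := slope_gt0 hV sV'; have lT := slope_intercept hV sV'.
  rewrite (slope_edge hV sV') in lT.
  have gE : vx R V k.+1 = gamma%:R by rewrite /vx eV.
  have dE : vy R V k.+1 = d%:R by rewrite /vy eV.
  have [xk _] := vertices_coord hV sV'.
  (* Here [e] is [gamma], and the presence of a vertex further left makes it positive; this settles
     the growth of the first height when [d = 1]. *)
  have g1 : 1 <= gamma%:R :> R.
    by move: xk; rewrite gE /vx ltr_nat ler1n; exact: leq_ltn_trans.
  have sedge := slope_edge hV sV'.
  rewrite gE dE in lT sedge; set l := slope R V k in l0 lT sedge *.
  have kl : l^-1 * l = 1 by rewrite mulVf // lt0r_neq0.
  have k0 : 0 < l^-1 by rewrite invr_gt0.
  (* Consequently [delta - kap * e - d] is [delta] minus the intercept, and the hypotheses on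
     [delta] give its sign. *)
  have TE : intercept R V k = l^-1 * gamma%:R + d%:R.
    by apply: (mulfI (lt0r_neq0 l0)); rewrite lT; field; exact: lt0r_neq0.
  exists 0, l^-1; split => //; first by split => //; exact: ltW.
  + move=> r r0; apply/seteqP; split=> u; rewrite /sector /hgtB /hgtA /= !mul0r !subr0.
      move=> [/(lt_normc_ln _ r0)[h1 h2]].
      move=> /(normc_powR_lt_ln _ r0 l0 (lt0r_neq0 l0) h1)[h3].
      by rewrite (divff (lt0r_neq0 l0)) mul1r [_ / l]mulrC => h4.
    move=> [h1 h2 h3 h4]; split; first exact/lt_normc_ln.
    apply/(normc_powR_lt_ln _ r0 l0 (lt0r_neq0 l0) h2).
    by rewrite (divff (lt0r_neq0 l0)) mul1r [_ / l]mulrC.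
  + exact: (vertex_support hV vV).
  + move=> i j cij.
    have := support_below_edge hV q0 sV' cij; rewrite -/l sedge => h1.
    have := support_left_of_last hV q0 cij; rewrite sV /= gE => h2.
    split; first by lra.
    have ee x y : l^-1 * (x + l * y) = l^-1 * x + y by field; exact: lt0r_neq0.
    by have := ler_wpM2l (ltW k0) h1; rewrite !ee; lra.
  + have kg : 0 < l^-1 * gamma%:R by rewrite mulr_gt0 //; lra.
    rewrite TE in Td.
    have g0' : 0 <= delta%:R - l^-1 * gamma%:R - d%:R by lra.
    have := mulr_ge0 (ltW k0) g0'.
    rewrite !mul0r subr0 addr0 => kg0; split => //; try lra.
    case: dcase => [d2|[dd hT]]; first by lra.
    have : intercept R V k != delta%:R by apply/eqP => /esym; exact: hT.
    rewrite TE => ne; have : l^-1 * gamma%:R + d%:R < delta%:R by rewrite lt_neqAle ne.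
    lra.
- move=> k gamma d l1 l2 sV /andP[Td dT] eV -> lE.
  have sV' : (k.+1 < size V)%N by exact: ltnW.
  have vV : (gamma, d) \in V by rewrite -eV mem_nth.
  move=> dcase d1 g0.
  have l0 := slope_gt0 hV sV; have lT := slope_intercept hV sV.
  have m0 := slope_gt0 hV sV'; have mT := slope_intercept hV sV'.
  have medge := slope_edge hV sV'.
  rewrite medge in mT.
  have gE : vx R V k.+1 = gamma%:R by rewrite /vx eV.
  have dE : vy R V k.+1 = d%:R by rewrite /vy eV.
  have sd := slope_decreasing hV sV.
  rewrite gE dE in lT mT medge.
  set m := slope R V k in lE m0 mT medge sd *; set l := slope R V k.+1 in lE l0 lT sd *.
  have l20 : 0 < l2 by lra.
  have mE : m = l + l2 by lra.
  have kl : l2^-1 * l2 = 1 by rewrite mulVf // lt0r_neq0.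
  have k0 : 0 < l2^-1 by rewrite invr_gt0.
  set kap := l2^-1 in kl k0 *.
  have km : kap * m = 1 + l * kap by rewrite mE mulrDr kl; ring.
  have lTd : 0 <= l * (intercept R V k.+1 - delta%:R) by rewrite mulr_ge0 ?subr_ge0 // ltW.
  have mTd : 0 <= kap * m * (delta%:R - intercept R V k).
    by apply: mulr_ge0; [exact: mulr_ge0 (ltW k0) (ltW m0)|rewrite subr_ge0].
  have gE' : delta%:R - kap * (gamma%:R + l * d%:R - l * delta%:R) - d%:R =
     kap * m * (delta%:R - intercept R V k).
    have mTk : kap * m * intercept R V k = kap * gamma%:R + (1 + l * kap) * d%:R.
      by rewrite -[LHS]mulrA mT -km; ring.
    by rewrite [RHS]mulrBr mTk km; ring.
  have lE' : gamma%:R + l * d%:R - l * delta%:R = l * (intercept R V k.+1 - delta%:R).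
    by rewrite [RHS]mulrBr lT.
  exists l, kap; split => //; first by split; exact: ltW.
  + move=> r r0; rewrite lE; apply/seteqP; split=> u; rewrite /sector /hgtB /hgtA /=.
      move=> [hA hB].
      (* The order matters: the lower bound on [normc u.2] gives [u.2 != 0], the upper bound then
         gives [u.1 != 0], and only now can the lower bound be put in logarithmic form. *)
      have w0 : u.2 != 0.
        by rewrite -normc_gt0; apply: le_lt_trans hA; rewrite mulr_ge0 ?powR_ge0 // ltW.
      have [h1 h2] := (normc_powR_lt_ln _ r0 l20 (lt0r_neq0 m0) w0).1 hB.
      have [_ h3] := (lt_powR_normc_ln _ _ r0 h1).1 hA.
      split => //; move: h2.
      have -> : m / l2 = 1 + l * kap by rewrite mulrC km.
      by rewrite -/kap; lra.
    move=> [h1 h2 h3 h4]; split; first exact/lt_powR_normc_ln.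
    apply/(normc_powR_lt_ln _ r0 l20 (lt0r_neq0 m0) h2); split => //.
    have -> : m / l2 = 1 + l * kap by rewrite mulrC km.
    by rewrite -/kap; lra.
  + exact: (vertex_support hV vV).
  + move=> i j cij.
    have := support_below_edge hV q0 sV cij; rewrite -/l gE dE => h1.
    have := support_below_edge hV q0 sV' cij; rewrite -/m medge => h2.
    split; first by lra.
    have ee x y : kap * (x + m * y) = kap * x + (1 + l * kap) * y by rewrite -km; ring.
    by have := ler_wpM2l (ltW k0) h2; rewrite !ee; lra.
  + rewrite /= lE' in gE' *; rewrite gE'.
    set e := l * (_ - _) in lTd gE' *; set g := kap * m * _ in mTd gE' *.
    have ke0 := mulr_ge0 (ltW k0) lTd; have kg0 := mulr_ge0 (ltW k0) mTd.
    have DE : delta%:R - kap * e = g + d%:R by lra.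
    rewrite DE; split => //; try lra.
    * case: dcase => [d2|[dd hT]]; first by lra.
      have ne : intercept R V k.+1 != delta%:R by apply/eqP => /esym; exact: hT.
      have : 0 < e by rewrite mulr_gt0 // subr_gt0 lt_neqAle eq_sym ne.
      lra.
    * case: dcase => [d2|[dd hT]]; first by lra.
      have ne : intercept R V k != delta%:R by apply/eqP => /esym; exact: hT.
      have : 0 < g.
        by apply: mulr_gt0; [exact: mulr_gt0 k0 m0|rewrite subr_gt0 lt_neqAle ne].
      lra.
Qed.

(** * Expansion at infinity *)

Section PolynomialExpansions.
Variable R : realType.
Implicit Types (p : {poly R[i]}) (q : {poly {poly R[i]}}).

Lemma decay_sum (l kap : R) (I : finType) (P : pred I) (h : I -> C2 R -> R[i]) :
  (forall x, P x -> exists c C, [/\ 0 < c, 0 <= C, decay l kap c C 0 (h x) &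
     analytic l kap 0 (h x)]) ->
  exists c C, [/\ 0 < c, 0 <= C, decay l kap c C 0 (fun u => \sum_(x | P x) h x u) &
     analytic l kap 0 (fun u => \sum_(x | P x) h x u)].
Proof.
move=> hP; elim: (index_enum I) => [|x s [c [C [c0 C0 dC aC]]]].
  exists 1, 0; split => //.
    by move=> t _; split=> [u _|u s _ _]; rewrite !big_nil ?subrr normc_0 !mul0r.
  move=> u _; rewrite (_ : (fun u => _) = fun=> 0); first exact: differentiable_const_C2.
  by apply/funext => v; rewrite big_nil.
have [Px|nPx] := boolP (P x); last first.
  rewrite (_ : (fun u => _) = fun u => \sum_(y <- s | P y) h y u); first by exists c, C.
  by apply/funext => v; rewrite big_cons (negPf nPx).
have [c' [C' [c'0 C'0 dC' aC']]] := hP x Px.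
rewrite (_ : (fun u => _) = fun u => h x u + \sum_(y <- s | P y) h y u); last first.
  by apply/funext => v; rewrite big_cons Px.
exists (Num.min c' c), (C' + C); split.
- by rewrite lt_min c'0.
- exact: addr_ge0.
- apply: decayD.
    by apply: decay_weaken dC' => //; rewrite ge_min lexx.
  by apply: decay_weaken dC => //; rewrite ge_min lexx orbT.
- by move=> u su; apply: differentiable_add_C2; [exact: aC'|exact: aC].
Qed.

Lemma differentiable_sum_C2 (I : finType) (h : I -> C2 R -> R[i]) u :
  (forall x, differentiable (h x : C2 R -> R[i]^o) u) ->
  differentiable (fun v : C2 R => \sum_x h x v : R[i]^o) u.
Proof.
move=> dh; elim: (index_enum I) => [|x s IH].
  rewrite (_ : (fun v => _) = fun=> 0); first exact: differentiable_const_C2.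
  by apply/funext => v; rewrite big_nil.
rewrite (_ : (fun v => _) = fun v => h x v + \sum_(y <- s) h y v).
  exact: differentiable_add_C2.
by apply/funext => v; rewrite big_cons.
Qed.

Definition inner_bound q := (\max_(i < size q) size (q`_i)%R)%N.

Lemma horner2_expand q z w :
  q.[z, w] = \sum_(x : 'I_(size q) * 'I_(inner_bound q)) q`_(x.1)`_(x.2) * z ^+ x.1 * w ^+ x.2.
Proof.
rewrite (horner_coef q) horner_sum.
rewrite -(pair_bigA _ (fun i j => q`_(nat_of_ord i)`_(nat_of_ord j) * z ^+ i * w ^+ j)) /=.
apply: eq_bigr => i _; rewrite hornerM horner_exp hornerC.
rewrite (@horner_coef_wide _ (inner_bound q)); last exact: (leq_bigmax i).
by rewrite mulr_suml; apply: eq_bigr => j _; rewrite mulrAC.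
Qed.

Lemma skew_product_differentiable p q (u : C2 R) :
  differentiable (fun v : C2 R => (skew_product p q v).1 : R[i]^o) u /\
  differentiable (fun v : C2 R => (skew_product p q v).2 : R[i]^o) u.
Proof.
split.
- rewrite (_ : (fun v : C2 R => _) = fun v : C2 R => \sum_(i < size p) p`_i * v.1 ^+ i).
    apply: differentiable_sum_C2 => i; apply: differentiable_mul_C2.
      exact: differentiable_const_C2.
    by apply: differentiable_pow_C2; exact: differentiable_fst_C2.
  by apply/funext => v; rewrite /skew_product /= horner_coef.
- rewrite (_ : (fun v : C2 R => _) = fun v : C2 R =>
    \sum_(x : 'I_(size q) * 'I_(inner_bound q)) q`_(x.1)`_(x.2) * v.1 ^+ x.1 * v.2 ^+ x.2).
    apply: differentiable_sum_C2 => x; apply: differentiable_mul_C2.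
      apply: differentiable_mul_C2; first exact: differentiable_const_C2.
      by apply: differentiable_pow_C2; exact: differentiable_fst_C2.
    by apply: differentiable_pow_C2; exact: differentiable_snd_C2.
  by apply/funext => v; rewrite /skew_product /= horner2_expand.
Qed.

Lemma base_leading_term (l kap : R) p delta : 0 <= l -> 0 <= kap ->
  size p = delta.+1 -> exists c C zeta, [/\ 0 < c, 0 <= C,
    decay l kap c C 0 zeta, analytic l kap 0 zeta &
    forall u, sector l kap 0 u ->
      p.[u.1] = lead_coef p * u.1 ^+ delta * (1 + zeta u)].
Proof.
move=> l0 kap0 sp; have a0 : lead_coef p != 0 by rewrite lead_coef_eq0 -size_poly_gt0 sp.
pose zt (i : 'I_delta) := monomial_ratio (p`_i / lead_coef p) i 0 delta 0.
have [|c [C [c0 C0 dC aC]]] := @decay_sum l kap 'I_delta predT zt.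
  move=> i _; have i1 : (i%:R : R) + 1 <= delta%:R by rewrite natr1 ler_nat.
  have k1 : 0 <= kap * (delta%:R - i%:R) by rewrite mulr_ge0 //; lra.
  by apply: decay_monomial_ratio => //; lra.
exists c, C, (fun u => \sum_i zt i u); split => // u [u1 u2 _ _].
rewrite horner_coef sp big_ord_recr /= mulrDr mulr1 addrC.
have -> : p`_delta = lead_coef p by rewrite lead_coefE sp.
congr (_ + _); rewrite mulr_sumr; apply: eq_bigr => i _.
by have := monomial_ratioE p`_i i 0 delta 0 a0 u1 u2; rewrite !expr0 !mulr1.
Qed.

Lemma fiber_leading_term (l kap : R) q gamma d :
  q`_gamma`_d != 0 ->
  (forall i j, q`_i`_j != 0 ->
    0 <= (gamma%:R - i%:R) + l * (d%:R - j%:R) :> R /\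
    0 <= kap * (gamma%:R - i%:R) + (1 + l * kap) * (d%:R - j%:R)) ->
  exists c C eta, [/\ 0 < c, 0 <= C,
    decay l kap c C 0 eta, analytic l kap 0 eta &
    forall u, sector l kap 0 u ->
      q.[u.1, u.2] = q`_gamma`_d * u.1 ^+ gamma * u.2 ^+ d * (1 + eta u)].
Proof.
move=> b0 hq; set b := q`_gamma`_d in b0 *.
have gq : (gamma < size q)%N.
  by rewrite ltnNge; apply: contraNN b0 => h; rewrite /b (nth_default _ h) coef0.
have dM : (d < inner_bound q)%N.
  apply: (@leq_trans (size q`_gamma)); last exact: (leq_bigmax (Ordinal gq)).
  by rewrite ltnNge; apply: contraNN b0 => h; rewrite /b (nth_default _ h).
pose T := ('I_(size q) * 'I_(inner_bound q))%type.
pose x0 : T := (Ordinal gq, Ordinal dM).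
pose et (x : T) := monomial_ratio (q`_(x.1)`_(x.2) / b) x.1 x.2 gamma d.
have [|c [C [c0 C0 dC aC]]] := @decay_sum l kap T (fun x => (x != x0) && (q`_(x.1)`_(x.2) != 0)) et.
  move=> [i j] /andP[ne cij]; have [e1 e2] := hq _ _ cij.
  (* The hypotheses provide nonnegative exponents only. As linear forms in [(gamma - i, d - j)] the
     two exponents have determinant 1, so they vanish together only at the vertex itself, and every
     other monomial really decays. *)
  apply: decay_monomial_ratio => //; rewrite lt_neqAle addr_ge0 // andbT eq_sym paddr_eq0 //.
  apply: contraNN ne => /andP[/eqP z1 /eqP z2].
  have dj : d%:R = j%:R :> R.
    apply/eqP; rewrite -subr_eq0 -z2 /=; apply/eqP.
    transitivity (kap * ((gamma%:R - i%:R) + l * (d%:R - j%:R)) + (d%:R - j%:R) : R); last by ring.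
    by rewrite z1 mulr0 add0r.
  move: z1; rewrite dj subrr mulr0 addr0 => /eqP; rewrite subr_eq0 eqr_nat => /eqP gi.
  move/eqP: dj; rewrite eqr_nat => /eqP dj.
  by apply/eqP; congr pair; apply: val_inj; rewrite /= ?gi ?dj.
exists c, C, (fun u => \sum_(x | (x != x0) && (q`_(x.1)`_(x.2) != 0)) et x u).
split => // u [u1 u2 _ _].
rewrite horner2_expand (bigD1 x0) //= -/b mulrDr mulr1; congr (_ + _).
rewrite (bigID (fun x : T => q`_(x.1)`_(x.2) != 0)) /= [X in _ + X]big1 ?addr0; last first.
  by move=> x /andP[_ /negPn/eqP ->]; rewrite !mul0r.
by rewrite mulr_sumr; apply: eq_bigr => x _; rewrite monomial_ratioE.
Qed.

End PolynomialExpansions.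

Theorem theorem1p2 (R : realType) (p : {poly R[i]}) (q : {poly {poly R[i]}})
    (delta : nat) (V : seq (nat * nat)) (gamma d : nat) (U : R -> set (C2 R)) :
  delta = (size p).-1 ->
  (2 <= delta)%N ->
  (2 <= total_degree q)%N ->
  newton_vertices q V ->
  skew_case V delta gamma d U ->
  (2 <= d)%N \/
    (d = 1%N /\
     forall k, (k.+1 < size V)%N -> delta%:R <> intercept R V k) ->
  exists2 r0 : R, 0 < r0 &
    forall r : R, r0 <= r ->
      exists phi : C2 R -> C2 R,
        [/\ biholomorphic_onto_image (U r) phi,
            conjugates_on (U r) phi (skew_product p q)
              (monomial_model p q gamma d) &
            forall eps : R, 0 < eps ->
              exists2 r1 : R, r <= r1 &
                forall u : C2 R, U r1 u ->
                  normc ((phi u).1 - u.1) < eps * normc u.1 /\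
                  normc ((phi u).2 - u.2) < eps * normc u.2].
Proof.
move=> deltaE delta2 deg2 hV hU hd.
have [l [kap [[l0 kap0] UE b0 hq [e0 eA eB0 eB1 eB]]]] :=
  newton_sector hV delta2 deg2 hU hd.
have d0 : (0 < d)%N by case: hd => [|[-> //]]; exact: leq_trans.
have sp : size p = delta.+1.
  by rewrite deltaE prednK //; move: delta2; rewrite deltaE; case: (size p).
have a0 : lead_coef p != 0 by rewrite lead_coef_eq0 -size_poly_gt0 sp.
have [cz [Cz [zeta [cz0 Cz0 dz az pE]]]] := base_leading_term l0 kap0 sp.
have [ce [Ce [eta [ce0 Ce0 de ae qE]]]] := fiber_leading_term b0 hq.
have an1 : analytic l kap 0 (fun u => (skew_product p q u).1).
  by move=> u _; have [] := skew_product_differentiable p q u.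
have an2 : analytic l kap 0 (fun u => (skew_product p q u).2).
  by move=> u _; have [] := skew_product_differentiable p q u.
have delta0 : (0 < delta)%N by exact: leq_trans delta2.
have [t1 t10 ht1] := conjugacy_in_sector l0 kap0 a0 b0 delta0 d0 cz0 Cz0 dz az
  ce0 Ce0 de ae an1 an2 pE qE e0 eA eB0 eB1 eB.
(* [U r] is the sector of level [ln r], so thresholds on levels become thresholds on [r] through
   [expR]. *)
exists (expR t1); first exact: expR_gt0.
move=> r hr; have r0 : 0 < r by apply: lt_le_trans hr; exact: expR_gt0.
have t1r : t1 <= ln r by rewrite -(expRK t1) ler_ln ?posrE ?expR_gt0.
have [phi [bih conj small]] := ht1 _ t1r.
exists phi; rewrite UE //; split => //.
  case: conj => h1 h2; split => // u su.
  by rewrite h2 // /monomial_model -deltaE.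
(* The same [phi] serves every [eps]; only the region where the estimate is claimed shrinks. *)
move=> eps eps0; have [T rT hT] := small _ eps0.
exists (expR T); first by rewrite -(lnK (_ : r \is Num.pos)) ?posrE // ler_expR.
by move=> u; rewrite UE ?expR_gt0 // expRK; exact: hT.
Qed.
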